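(* Let $\mathbf{x}=x_1,\ldots,x_n$ be differential indeterminates over $\mathbb{C}$, $e\ge1$, and $\mathbf{f}=f_1,\ldots,f_s$ differential polynomials in $\mathbb{C}[\mathbf{x},\dot{\mathbf{x}},\ldots,\mathbf{x}^{(e)}]$. Let $V\subset\mathbb{C}^{n(e+1)}$ be the algebraic variety defined by $\{\mathbf{f}=0\}$ (viewing $\mathbf{f}$ as ordinary polynomials in the $n(e+1)$ variables $x_i^{(j)}$, $0\le j\le e$), and let $\nu:=\max\{1,\dim(V)\}$ and $D:=\max\{\deg(\mathbf{f}),\deg(V)\}$. Then $$1\in[\mathbf{f}]\quad\Longleftrightarrow\quad 1\in(\mathbf{f},\ldots,\mathbf{f}^{(L)}),$$ where $L\le(n(e+1)D)^{2^{c\nu^2n(e+1)}}$ for a universal constant $c>0$.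
   Context: $\mathbb{C}\{\mathbf{x}\}$ is the differential polynomial ring $\mathbb{C}[x_i^{(p)}:p\in\mathbb{N}_0]$ with derivation $x_i^{(p)}\mapsto x_i^{(p+1)}$ and $\mathbb{C}$ as constants; $\mathbf{f}^{(p)}$ is the family of $p$-th total derivatives; $[\mathbf{f}]$ is the differential ideal generated by $\mathbf{f}$, and $(\cdot)$ is the ordinary polynomial ideal in the polynomial ring in the finitely many variables involved. Degree of a variety: sum over irreducible components of the number of intersection points with a generic affine linear subspace of complementary dimension; the empty set has dimension $-1$. *)

(* Defs.v *)
From HB Require Import structures.
From mathcomp Require Import all_boot all_order all_algebra.
From mathcomp Require Import mpoly.
From mathcomp Require Import complex.
From mathcomp Require Import reals.

Set Implicit Arguments.
Unset Strict Implicit.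
Unset Printing Implicit Defensive.
Import Order.TTheory GRing.Theory Num.Theory.
Local Open Scope ring_scope.

Section AffineGeometry.
Variable C : fieldType.

Definition pts (N : nat) := {ffun 'I_N -> C}.

Definition subsetZ N (A B : pts N -> Prop) := forall x, A x -> B x.
Definition eqZ N (A B : pts N -> Prop) := forall x, A x <-> B x.
Definition strictZ N (A B : pts N -> Prop) :=
  subsetZ A B /\ exists x, B x /\ ~ A x.

Definition zero_set N (gs : seq {mpoly C[N]}) : pts N -> Prop :=
  fun x => forall g, g \in gs -> g.@[x] = 0.

Definition closedZ N (Z : pts N -> Prop) :=
  exists gs : seq {mpoly C[N]}, eqZ Z (zero_set gs).

Definition irreducibleZ N (Z : pts N -> Prop) :=
  [/\ closedZ Z, (exists x, Z x) &
    forall A B : pts N -> Prop, closedZ A -> closedZ B ->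
      eqZ Z (fun x => A x \/ B x) -> subsetZ Z A \/ subsetZ Z B].

Definition dim_ge N (V : pts N -> Prop) (r : nat) :=
  exists Z : nat -> pts N -> Prop,
    [/\ forall i, (i <= r)%N -> irreducibleZ (Z i),
        forall i, (i < r)%N -> strictZ (Z i) (Z i.+1) &
        subsetZ (Z r) V].

Definition is_dimn N (V : pts N -> Prop) (r : nat) :=
  dim_ge V r /\ ~ dim_ge V r.+1.

Definition is_dim N (V : pts N -> Prop) (d : int) :=
  ((forall x, ~ V x) /\ d = -1) \/ (exists r : nat, d = r%:Z /\ is_dimn V r).

(* The affine linear subspace { x | sum_j a_ij x_j = b_i, i < r } of C^N,
   with parameters (a_ij, b_i) stored as an r x (N+1) matrix,
   column N being b. *)
Definition aff_sub N r (v : pts (r * N.+1)) : pts N -> Prop :=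
  fun x => forall i : 'I_r,
    \sum_(j < N) v (mxvec_index i (widen_ord (leqnSn N) j)) * x j
    = v (mxvec_index i ord_max).

Definition card_is N (P : pts N -> Prop) (k : nat) :=
  exists s : seq (pts N), [/\ uniq s, size s = k & forall x, x \in s <-> P x].

(* degree of an irreducible variety W of dimension r: the number of points of
   W cap H for a generic affine subspace H of dimension N - r, "generic"
   meaning: for all parameters outside the zero set of some nonzero
   polynomial on the parameter space. *)
Definition irr_degree N (W : pts N -> Prop) (k : nat) :=
  exists r : nat, is_dimn W r /\
    exists h : {mpoly C[r * N.+1]}, h != 0 /\
      forall v : pts (r * N.+1), h.@[v] != 0 ->
        card_is (fun x => W x /\ aff_sub v x) k.

Definition componentZ N (V Z : pts N -> Prop) :=
  [/\ irreducibleZ Z, subsetZ Z V &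
    forall Z', irreducibleZ Z' -> subsetZ Z Z' -> subsetZ Z' V -> subsetZ Z' Z].

Definition is_degree N (V : pts N -> Prop) (k : nat) :=
  exists (m : nat) (W : 'I_m -> pts N -> Prop) (dW : 'I_m -> nat),
    [/\ forall i j, eqZ (W i) (W j) -> i = j,
        forall Z, componentZ V Z <-> exists i, eqZ Z (W i),
        forall i, irr_degree (W i) (dW i) &
        k = (\sum_(i < m) dW i)%N].

(* Variables of {mpoly C[K]}: index v stands for x_(v mod n)^(v div n),
   so {mpoly C[(e+1)*n]} = C[x, x', ..., x^(e)]. *)

(* ring embedding C[X_0..X_(K-1)] -> C[X_0..X_(K'-1)], X_v |-> X_v
   (exact when K <= K') *)
Definition liftv K K' (v : 'I_K) : {mpoly C[K']} :=
  match insub (val v) with Some w => 'X_w | None => 0 end.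
Definition liftP K K' (p : {mpoly C[K]}) : {mpoly C[K']} :=
  p \mPo [tuple liftv K' v | v < K].

(* the derivation x_i^(p) |-> x_i^(p+1), i.e. X_v |-> X_(v+n) *)
Definition dervP n K (p : {mpoly C[K]}) : {mpoly C[n + K]} :=
  \sum_(v < K) liftP (n + K) (p^`M(v)) * 'X_(rshift n v).

Fixpoint lvl n m j : nat := match j with 0 => m | j'.+1 => (n + lvl n m j')%N end.

Fixpoint dder n m j (p : {mpoly C[m]}) : {mpoly C[lvl n m j]} :=
  match j return {mpoly C[lvl n m j]} with
  | 0 => p
  | j'.+1 => dervP n (dder n j' p)
  end.

Definition ders n m s (f : 'I_s -> {mpoly C[m]}) L K : seq {mpoly C[K]} :=
  flatten [seq [seq liftP K (@dder n m j (f i)) | i <- enum 'I_s] | j <- iota 0 L.+1].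

Definition one_in_ideal K (gs : seq {mpoly C[K]}) :=
  exists cs : seq {mpoly C[K]}, \sum_(i < size gs) cs`_i * gs`_i = 1.

(* 1 in [f]: 1 is a polynomial combination (coefficients in C{x}, i.e. in
   some C[X_0..X_(K-1)]) of finitely many derivatives of the f_i *)
Definition one_in_diff_ideal n m s (f : 'I_s -> {mpoly C[m]}) :=
  exists L K, (lvl n m L <= K)%N /\ one_in_ideal (ders n f L K).

Definition Vset m s (f : 'I_s -> {mpoly C[m]}) : pts m -> Prop :=
  fun x => forall i, (f i).@[x] = 0.

Definition degf m s (f : 'I_s -> {mpoly C[m]}) : nat :=
  (\max_(i < s) (msize (f i)).-1)%N.

End AffineGeometry.

Definition nu_of (d : int) : nat := if (d < 0)%R then 1%N else maxn 1 (absz d).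

(* Main.v *)
(**
  A common zero of [f, ..., f^(L)] over a field [k] is a jet [p(t)] with
  [f(p) = 0 mod t^(L+1)]. Call linear forms in the coordinates of [p]
  independent at level [r] if they satisfy no nonzero polynomial relation of
  degree at most [D_r] modulo [t^(L_r)]. Take [r] such that some [r] forms are
  independent at level [r] but no [r+1] forms are at level [r+1], where
  [D_r = D_(r+1)^4] and [L_(r+1) = L_r * D_(r+1)^2]. A fresh generic form
  [th = sum_j u_j x_j] then satisfies over the [r] forms [Y] a prime relation
  [F(u, Y, th) = 0] to high order. Differentiating in [u_j] gives
  [x_j = - F_(u_j) / F_th], which defines a point [xi] with coordinates in
  [E = Frac(k[u, Y, th] / F)]. Taking resultants with [F] in [th] shows that a
  polynomial of low degree vanishing to order [L_r] at [p] vanishes at [xi];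
  conversely the relations of low degree among the [xi_j] vanish to such a high
  order at [p] that their derivatives in [t] again vanish at [xi]. Hence
  [xi_v |-> xi_(v+n)] extends to a derivation of [E], and [xi] is a solution of
  [f] in a differential field, so that [1] is not in [[f]]. There are only
  [N + 1] levels, which bounds the final [L] by [D^(2^(O(N)))].
*)
Require Import Defs.
From HB Require Import structures.
From mathcomp Require Import all_boot all_order all_algebra.
From mathcomp Require Import mpoly.
From mathcomp Require Import complex.
From mathcomp Require Import reals.
From mathcomp Require Import perm ring zify.
From mathcomp Require boolp classical_sets.
Set Implicit Arguments.
Unset Strict Implicit.
Unset Printing Implicit Defensive.
Import Order.TTheory GRing.Theory Num.Theory.
Local Open Scope ring_scope.

(** * Unique factorization *)

Lemma mpoly_rmorph_ext (n : nat) (R : nzRingType) (S : nzRingType)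
    (phi psi : {rmorphism {mpoly R[n]} -> S}) :
  (forall c, phi c%:MP = psi c%:MP) -> (forall i, phi 'X_i = psi 'X_i) ->
  phi =1 psi.
Proof.
move=> eqC eqX p; rewrite [p]mpolyE !rmorph_sum; apply: eq_bigr => m _.
rewrite -mul_mpolyC mpolyXE_id !rmorphM /= eqC; congr (_ * _).
rewrite !rmorph_prod; apply: eq_bigr => i _; by rewrite !rmorphXn /= eqX.
Qed.

Lemma poly_rmorph_ext (R : nzRingType) (S : nzRingType)
    (phi psi : {rmorphism {poly R} -> S}) :
  (forall c, phi c%:P = psi c%:P) -> phi 'X = psi 'X -> phi =1 psi.
Proof.
move=> eqC eqX p; rewrite -[p]coefK poly_def !rmorph_sum; apply: eq_bigr => i _.
by rewrite -mul_polyC !rmorphM !rmorphXn /= eqC eqX.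
Qed.

Section Divisibility.
Variable R : idomainType.
Implicit Types a b c p : R.

Definition dvdr a b := exists c, b = c * a.
Definition is_prime p :=
  [/\ p != 0, p \isn't a GRing.unit & forall a b, dvdr p (a * b) -> dvdr p a \/ dvdr p b].
(** Only existence of a factorization is required: the factors are prime, not merely irreducible, so
    uniqueness up to units follows. *)
Definition is_ufd := forall a, a != 0 ->
  exists2 s : seq R, (forall p, p \in s -> is_prime p) &
    exists2 u, u \is a GRing.unit & a = u * \prod_(p <- s) p.

Lemma dvdr_mull c a b : dvdr a b -> dvdr a (c * b).
Proof. by case=> d ->; exists (c * d); rewrite mulrA. Qed.
Lemma dvdr_mulr c a b : dvdr a b -> dvdr a (b * c).
Proof. by rewrite mulrC; apply: dvdr_mull. Qed.
Lemma dvdr_refl a : dvdr a a. Proof. by exists 1; rewrite mul1r. Qed.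
Lemma dvdr0 a : dvdr a 0. Proof. by exists 0; rewrite mul0r. Qed.
Lemma dvdrD a b c : dvdr a b -> dvdr a c -> dvdr a (b + c).
Proof. by case=> x -> [y ->]; exists (x + y); rewrite mulrDl. Qed.
Lemma dvdrN a b : dvdr a b -> dvdr a (- b).
Proof. by case=> x ->; exists (- x); rewrite mulNr. Qed.
Lemma dvdrB a b c : dvdr a b -> dvdr a c -> dvdr a (b - c).
Proof. by move=> ab ac; apply: dvdrD => //; apply: dvdrN. Qed.
Lemma dvdr_unit a u : u \is a GRing.unit -> dvdr a u -> a \is a GRing.unit.
Proof. by move=> uu [c def_u]; move: uu; rewrite def_u unitrM => /andP[]. Qed.

End Divisibility.

Lemma field_is_ufd (K : fieldType) : is_ufd K.
Proof.
move=> a nz_a; exists [::] => //; exists a; first by rewrite unitfE.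
by rewrite big_nil mulr1.
Qed.

Section Transfer.
Variables (R S : idomainType) (f : {rmorphism R -> S}) (g : {rmorphism S -> R}).
Hypotheses (fK : cancel f g) (gK : cancel g f).

Lemma dvdr_iso a b : dvdr (f a) (f b) <-> dvdr a b.
Proof.
split=> [[c]|[c ->]]; last by exists (f c); rewrite rmorphM.
by move=> /(congr1 g); rewrite rmorphM !fK => ->; exists (g c).
Qed.

Lemma is_prime_iso p : is_prime p -> is_prime (f p).
Proof.
case=> nz_p nu_p pr_p; split=> [||a b].
- by apply: contraNneq nz_p => /(congr1 g); rewrite fK rmorph0 => ->.
- by apply: contra nu_p => up; rewrite -[p]fK rmorph_unit.
- rewrite -[a]gK -[b]gK -rmorphM => /dvdr_iso/pr_p[] /dvdr_iso ?; [by left|by right].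
Qed.

Lemma is_ufd_iso : is_ufd R -> is_ufd S.
Proof.
move=> ufdR a nz_a; have [|s pr_s [u uu def_a]] := ufdR (g a).
  by apply: contraNneq nz_a => /(congr1 f); rewrite gK rmorph0 => ->.
exists [seq f p | p <- s] => [_ /mapP[p /pr_s pr_p ->]|]; first exact: is_prime_iso.
exists (f u); first exact: rmorph_unit.
by rewrite -[a]gK def_a rmorphM rmorph_prod big_map.
Qed.

End Transfer.

Section UfdPoly.
Variable R : idomainType.
Hypothesis ufdR : is_ufd R.
Implicit Types (f g h : {poly R}) (p c : R) (s : seq R).

(** A way of saying, without gcds, that the content of [f] is a unit. *)
Definition primitive f := forall p, is_prime p -> ~ dvdr p%:P f.

Lemma dvdr_coef p f i : dvdr p%:P f -> dvdr p f`_i.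
Proof. by case=> g ->; rewrite coefMC; exists g`_i. Qed.

Lemma dvdr_lead_term p f : dvdr p (lead_coef f) ->
  dvdr p%:P (lead_coef f *: 'X^((size f).-1)).
Proof.
by case=> c ->; exists (c *: 'X^((size f).-1)); rewrite [RHS]mulrC mul_polyC scalerA [p * c]mulrC.
Qed.

Lemma size_sub_lead f : f != 0 ->
  (size (f - lead_coef f *: 'X^((size f).-1))%R < size f)%N.
Proof.
move=> nz_f; rewrite (polySpred nz_f) ltnS; apply/leq_sizeP => j.
rewrite leq_eqVlt => /orP[/eqP<-|lt_j]; rewrite coefB coefZ coefXn.
  by rewrite eqxx mulr1 -lead_coefE subrr.
rewrite (gtn_eqF lt_j) mulr0 subr0 nth_default //.
by rewrite (polySpred nz_f).
Qed.

(** Induction on the total size: [p] divides the product of the leading coefficients, hence one of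
    them, and that leading term can be subtracted without affecting the divisibility. *)
Lemma is_prime_polyC p : is_prime p -> is_prime p%:P.
Proof.
case=> nz_p nu_p pr_p; split=> [||f g]; first by rewrite polyC_eq0.
  by rewrite poly_unitE size_polyC nz_p coefC eqxx /=.
move: {2}(size f + size g)%N (leqnn (size f + size g)%N) => n.
elim: n f g => [|n IHn] f g le_n dv.
  left; move: le_n; rewrite leqn0 addn_eq0 size_poly_eq0 => /andP[/eqP-> _].
  exact: dvdr0.
have [->|nz_f] := eqVneq f 0; first by left; apply: dvdr0.
have [->|nz_g] := eqVneq g 0; first by right; apply: dvdr0.
have: dvdr p (lead_coef f * lead_coef g).
  by rewrite -lead_coefM lead_coefE; apply: dvdr_coef.
case/pr_p => /dvdr_lead_term dl.
  have [|//||] := IHn (f - lead_coef f *: 'X^((size f).-1)) g.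
  - by rewrite -ltnS; apply: leq_trans le_n; rewrite ltn_add2r size_sub_lead.
  - by rewrite mulrBl; apply: dvdrB => //; apply: dvdr_mulr.
  - by move=> /dvdrD/(_ dl); rewrite subrK; left.
  - by right.
have [|//||] := IHn f (g - lead_coef g *: 'X^((size g).-1)).
- by rewrite -ltnS; apply: leq_trans le_n; rewrite ltn_add2l size_sub_lead.
- by rewrite mulrBr; apply: dvdrB => //; apply: dvdr_mull.
- by left.
- by move=> /dvdrD/(_ dl); rewrite subrK; right.
Qed.

(** [p] is associate to one of the listed primes and is cancelled against it. The strictly shorter
    list drives the induction in [primitive_part]. *)
Lemma prime_cofactor p b s u : is_prime p -> (forall q, q \in s -> is_prime q) ->
  u \is a GRing.unit -> u * \prod_(q <- s) q = b * p ->
  exists2 s', (forall q, q \in s' -> is_prime q) /\ (size s' < size s)%N &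
    exists2 v, v \is a GRing.unit & b = v * \prod_(q <- s') q.
Proof.
move=> pr_p; have [nz_p nu_p dv_p] := pr_p.
elim: s b => [|q s IHs] b pr_s uu.
  rewrite big_nil mulr1 => def_u; case/negP: nu_p.
  by apply: (dvdr_unit uu); exists b.
rewrite big_cons mulrCA => def_b.
have pr_s' r : r \in s -> is_prime r by move=> rs; apply: pr_s; rewrite inE rs orbT.
have [nz_q nu_q dv_q] : is_prime q by apply: pr_s; rewrite inE eqxx.
have: dvdr p (q * (u * \prod_(q <- s) q)) by exists b.
case/dv_p => [[c def_q]|[b' def_b']].
  have: dvdr q (c * p) by exists 1; rewrite mul1r.
  case/dv_q => [[d def_c]|[d def_p]].
    case/negP: nu_p; apply/unitrP; exists d.
    have dp1 : d * p = 1.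
      by apply: (mulIf nz_q); rewrite mul1r mulrAC -def_c -def_q.
    by rewrite [p * d]mulrC dp1.
  have cd1 : c * d = 1 by apply: (mulIf nz_q); rewrite mul1r -mulrA -def_p.
  have uc : c \is a GRing.unit by apply/unitrP; exists d; rewrite [d * c]mulrC cd1.
  exists s => //; exists (c * u); first by rewrite unitrM uc.
  by apply: (mulIf nz_p); rewrite -def_b def_q; rewrite -!mulrA; congr (_ * _); rewrite mulrC mulrA.
have [s1 [pr_s1 lt_s1] [v uv def_v]] := IHs _ pr_s' uu def_b'.
exists (q :: s1).
  split=> [r|]; last by rewrite /= ltnS.
  by rewrite inE => /orP[/eqP-> //|]; apply: pr_s1.
exists v => //; apply: (mulIf nz_p); rewrite -def_b def_b' def_v big_cons.
by rewrite -!mulrA mulrCA.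
Qed.

(** Prime constants are divided out one at a time; each costs the leading coefficient a prime
    factor, so the process stops. *)
Lemma primitive_part f : f != 0 -> exists2 g, primitive g &
  exists2 s, (forall p, p \in s -> is_prime p) & f = (\prod_(p <- s) p)%:P * g.
Proof.
move=> nz_f; have [|s pr_s [u uu def_f]] := ufdR (a := lead_coef f).
  by rewrite lead_coef_eq0.
move: {2}(size s).+1 (ltnSn (size s)) => n.
elim: n f s u nz_f pr_s uu def_f => // n IHn f s u nz_f pr_s uu def_f lt_s.
case: (boolp.pselect (primitive f)) => [pf|/boolp.existsNP[p /boolp.not_implyP[pr_p]]].
  by exists f => //; exists [::] => //; rewrite big_nil mul1r.
move=> /boolp.contrapT[g def_g]; have [nz_p _ _] := pr_p.
have [|s' [pr_s' lt_s'] [v uv def_v]] := prime_cofactor (b := lead_coef g) pr_p pr_s uu.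
  by rewrite -def_f def_g lead_coefM lead_coefC.
have nz_g : g != 0 by apply: contraNneq nz_f => g0; rewrite def_g g0 mul0r.
have [|h ph [s1 pr_s1 def_h]] := IHn g s' v nz_g pr_s' uv def_v.
  by apply: leq_trans lt_s' _; rewrite -ltnS.
exists h => //; exists (p :: s1).
  by move=> q; rewrite inE => /orP[/eqP->|/pr_s1].
by rewrite def_g def_h big_cons polyCM mulrC mulrA.
Qed.

(** Each prime factor of [c] divides [g] or [h] by [is_prime_polyC] and is cancelled there. Thus a
    factorization over the fraction field descends to [R] with the same degrees. *)
Lemma split_scaled c f g h : c != 0 -> c%:P * f = g * h ->
  exists g' h', [/\ f = g' * h', size g' = size g & size h' = size h].
Proof.
case/ufdR => s pr_s [u uu ->].
elim: s g h pr_s => [|p s IHs] g h pr_s.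
  rewrite big_nil mulr1 => def_f; exists (u^-1%:P * g), h; split=> //.
    by rewrite -mulrA -def_f mulrA -polyCM mulVr // mul1r.
  by rewrite mul_polyC size_scale // invr_eq0; apply: contraTneq uu => ->; rewrite unitr0.
have pr_p : is_prime p by apply: pr_s; rewrite inE eqxx.
have pr_s' q : q \in s -> is_prime q by move=> qs; apply: pr_s; rewrite inE qs orbT.
have [nzp _ dvp] := is_prime_polyC pr_p.
have nz_p : p != 0 by rewrite -polyC_eq0.
rewrite big_cons mulrCA polyCM -mulrA => def_f.
have /dvp[[g1 def_g]|[h1 def_h]] : dvdr p%:P (g * h).
- by rewrite -def_f; apply: dvdr_mulr; apply: dvdr_refl.
- have [|g' [h' [-> sg sh]]] := IHs g1 h pr_s'.
    by apply: (mulfI nzp); rewrite def_f def_g mulrAC mulrC.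
  by exists g', h'; split=> //; rewrite sg def_g mulrC mul_polyC size_scale.
- have [|g' [h' [-> sg sh]]] := IHs g h1 pr_s'.
    by apply: (mulfI nzp); rewrite def_f def_h [RHS]mulrC -mulrA.
  by exists g', h'; split=> //; rewrite sh def_h mulrC mul_polyC size_scale.
Qed.

(** A prime factor of [c] cannot divide the primitive [f], so it divides the cofactor of [f] and
    cancels. *)
Lemma primitive_dvdr c f g : primitive f -> c != 0 -> dvdr f (c%:P * g) -> dvdr f g.
Proof.
move=> pf /ufdR[s pr_s [u uu ->]].
elim: s g pr_s => [|p s IHs] g pr_s.
  rewrite big_nil mulr1 => /(dvdr_mull u^-1%:P); by rewrite mulrA -polyCM mulVr // mul1r.
have pr_p : is_prime p by apply: pr_s; rewrite inE eqxx.
have pr_s' q : q \in s -> is_prime q by move=> qs; apply: pr_s; rewrite inE qs orbT.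
have [nzp _ dvp] := is_prime_polyC pr_p.
rewrite big_cons mulrCA polyCM -mulrA => -[q def_q].
have /dvp[[q1 def_q1]|/(pf _ pr_p)//] : dvdr p%:P (q * f).
  by rewrite -def_q; apply: dvdr_mulr; apply: dvdr_refl.
apply: (IHs _ pr_s'); exists q1; apply: (mulfI nzp).
by rewrite def_q def_q1 mulrAC mulrC.
Qed.

(* Gauss's lemma: [f] stays irreducible over the fraction field of [R]. *)
Lemma is_prime_irreducible f : primitive f -> (1 < size f)%N ->
  (forall g h, f = g * h -> (size g <= 1)%N \/ (size h <= 1)%N) -> is_prime f.
Proof.
move=> pf sf irr_f; have nz_f : f != 0 by rewrite -size_poly_gt0 ltnW.
(* Here [irreducible_poly] and [%|] allow nonzero scalar multiples, so they concern divisibility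
   over the fraction field. *)
have irr : irreducible_poly f.
  split=> // q sq qf; case/Pdiv.Idomain.dvdpP: (qf) => -[c q'] /= nz_c; rewrite -mul_polyC => def_f.
  have [g' [h' [/irr_f le1 sg sh]]] := split_scaled nz_c def_f.
  have [nz_q' nz_q] : q' != 0 /\ q != 0.
    by apply/andP; rewrite -negb_or -mulf_eq0 -def_f mulf_neq0 // polyC_eq0.
  have {le1} : (size q' <= 1)%N.
    case: le1; rewrite ?sg ?sh // => le1.
    by case/negP: sq; rewrite eqn_leq le1 lt0n size_poly_eq0.
  move=> le1; rewrite -(dvdp_size_eqp qf); apply/eqP.
  have : size (c%:P * f) = size (q' * q) by rewrite def_f.
  rewrite mul_polyC size_scale // size_mul // => ->.
  by move: le1 nz_q'; rewrite -size_poly_eq0; case: (size q') => [|[]].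
have gcd_f g : f %| g \/ coprimep f g.
  have [?|] := boolP (coprimep f g); first by right.
  by rewrite coprimep_def => /irr /(_ (dvdp_gcdl _ _)) /eqp_dvdl <-; left; apply: dvdp_gcdr.
have dvd_f g : f %| g -> dvdr f g.
  case/Pdiv.Idomain.dvdpP=> -[c q] /= nz_c; rewrite -mul_polyC => def_g.
  by apply: (primitive_dvdr pf nz_c); exists q.
split=> // [|g h [q def_q]].
  by rewrite poly_unitE gtn_eqF.
have fgh : f %| g * h by rewrite def_q dvdp_mull.
case: (gcd_f g) => [/dvd_f|co]; first by left.
by right; apply: dvd_f; rewrite -(Gauss_dvdpr h co).
Qed.

(** Induction on the size: if [f] is not prime, it splits into two smaller factors of positive
    degree, which are again primitive because a prime constant dividing a factor divides [f]. *)
Lemma primitive_ufd f : primitive f -> f != 0 ->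
  exists2 s : seq {poly R}, (forall g, g \in s -> is_prime g) &
    exists2 u, u \is a GRing.unit & f = u * \prod_(g <- s) g.
Proof.
move: {2}(size f).+1 (ltnSn (size f)) => n.
elim: n f => // n IHn f lt_n pf nz_f.
case: (leqP (size f) 1) => [/size1_polyC def_f|sf].
  have nz_c : f`_0 != 0 by rewrite -polyC_eq0 -def_f.
  have [[|p s] pr_s [u uu def_c]] := ufdR nz_c.
    exists [::] => //; exists f; last by rewrite big_nil mulr1.
    by rewrite def_f poly_unitE size_polyC nz_c coefC eqxx def_c big_nil mulr1.
  case: (pf p); first by apply: pr_s; rewrite inE eqxx.
  rewrite def_f def_c big_cons; exists (u * \prod_(q <- s) q)%:P.
  by rewrite -polyCM mulrCA mulrC.
case: (boolp.pselect (forall g h, f = g * h -> (size g <= 1)%N \/ (size h <= 1)%N)).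
  move=> /(is_prime_irreducible pf sf) pr_f; exists [:: f].
    by move=> p; rewrite inE => /eqP->.
  by exists 1; rewrite ?unitr1 // big_seq1 mul1r.
move=> /boolp.existsNP[g /boolp.existsNP[h /boolp.not_implyP[def_f]]].
move=> /boolp.not_orP[/negP]; rewrite -ltnNge => sg /negP; rewrite -ltnNge => sh.
have nz_g : g != 0 by rewrite -size_poly_gt0 ltnW.
have nz_h : h != 0 by rewrite -size_poly_gt0 ltnW.
have size_f : size f = (size g + size h).-1 by rewrite def_f size_mul.
have [|||s1 pr1 [u1 uu1 def_g]] := IHn g.
- rewrite -ltnS; apply: leq_trans lt_n; rewrite ltnS size_f.
  by case: (size h) sh => [|[|k]] // _; rewrite !addnS /= ltnS leq_addr.
- by move=> p pr_p dv; apply: (pf p pr_p); rewrite def_f; apply: dvdr_mulr.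
- exact: nz_g.
have [|||s2 pr2 [u2 uu2 def_h]] := IHn h.
- rewrite -ltnS; apply: leq_trans lt_n; rewrite ltnS size_f.
  by case: (size g) sg => [|[|k]] // _; rewrite !addSn /= ltnS leq_addl.
- by move=> p pr_p dv; apply: (pf p pr_p); rewrite def_f; apply: dvdr_mull.
- exact: nz_h.
exists (s1 ++ s2).
  by move=> p; rewrite mem_cat => /orP[/pr1|/pr2].
exists (u1 * u2); first by rewrite unitrM uu1.
by rewrite def_f {1}def_g {1}def_h big_cat /= mulrACA.
Qed.

Lemma poly_is_ufd : is_ufd {poly R}.
Proof.
move=> f nz_f; have [g pg [s pr_s def_f]] := primitive_part nz_f.
have nz_g : g != 0 by apply: contraNneq nz_f => g0; rewrite def_f g0 mulr0.
have [s' pr_s' [u uu def_g]] := primitive_ufd pg nz_g.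
exists ([seq p%:P | p <- s] ++ s').
  move=> p; rewrite mem_cat => /orP[/mapP[q /pr_s qs ->]|/pr_s' //].
  exact: is_prime_polyC.
exists u => //; rewrite def_f {1}def_g big_cat /= big_map mulrCA; congr (_ * (_ * _)).
by rewrite rmorph_prod.
Qed.

End UfdPoly.

Section UniIso.
Variables (n : nat) (R : comNzRingType).

(** The inverse of [muni]: the univariate variable becomes the last of the [n.+1] variables. *)
Definition of_uni : {poly {mpoly R[n]}} -> {mpoly R[n.+1]} :=
  horner_morph (fun p => mulrC ('X_ord_max : {mpoly R[n.+1]}) (@mwiden n R p)).
HB.instance Definition _ := GRing.RMorphism.on of_uni.

Lemma of_uniC c : of_uni c%:P = mwiden c. Proof. exact: horner_morphC. Qed.
Lemma of_uniX : of_uni 'X = 'X_ord_max. Proof. exact: horner_morphX. Qed.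

Lemma muni_ord_max : muni ('X_ord_max : {mpoly R[n.+1]}) = 'X.
Proof.
rewrite muniE msuppX big_seq1 mcoeffX eqxx scale1r mnmE eqxx expr1.
rewrite [X in 'X_[X]](_ : _ = 0%MM) ?mpolyX0 ?scale1r //.
by apply/mnmP=> i; rewrite !mnmE -val_eqE /= gtn_eqF.
Qed.

Lemma muni_widen (i : 'I_n) : muni ('X_(widen_ord (leqnSn n) i) : {mpoly R[n.+1]}) = ('X_i)%:P.
Proof.
rewrite muniE msuppX big_seq1 mcoeffX eqxx scale1r mnmE -val_eqE /= ltn_eqF // expr0.
rewrite -mul_polyC mulr1; congr ('X_[_])%:P.
by apply/mnmP=> j; rewrite !mnmE -val_eqE.
Qed.

Lemma mwidenXU (i : 'I_n) : mwiden ('X_i : {mpoly R[n]}) = 'X_(widen_ord (leqnSn n) i).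
Proof. by rewrite /mwiden mmapX mmap1U. Qed.

Lemma muni_mwiden (p : {mpoly R[n]}) : muni (mwiden p) = p%:P.
Proof.
have := @mpoly_rmorph_ext n R {poly {mpoly R[n]}} (@muni n R \o @mwiden n R) polyC.
apply=> [c|i] /=; first by rewrite mwidenC muniC.
by rewrite mwidenXU muni_widen.
Qed.

Lemma of_uniK : cancel of_uni (@muni n R).
Proof.
move=> p; have := @poly_rmorph_ext {mpoly R[n]} {poly {mpoly R[n]}} (@muni n R \o of_uni) idfun.
apply=> [c|] /=; first by rewrite of_uniC muni_mwiden.
by rewrite of_uniX muni_ord_max.
Qed.

Lemma muniK : cancel (@muni n R) of_uni.
Proof.
move=> p; have := @mpoly_rmorph_ext n.+1 R {mpoly R[n.+1]} (of_uni \o @muni n R) idfun.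
apply=> [c|i] /=; first by rewrite muniC of_uniC mwidenC.
have [j ->|->] := unliftP ord_max i; last by rewrite muni_ord_max of_uniX.
have -> : lift ord_max j = widen_ord (leqnSn n) j.
  by apply: val_inj; rewrite /= /bump leqNgt ltn_ord.
by rewrite muni_widen of_uniC mwidenXU.
Qed.

End UniIso.

Lemma mpoly_is_ufd (n : nat) (R : idomainType) : is_ufd R -> is_ufd {mpoly R[n]}.
Proof.
move=> ufdR; elim: n => [|n IHn].
  apply: (@is_ufd_iso R {mpoly R[0]} (@mpolyC 0 R) (meval (fun _ => 0))) => // [c|p].
    exact: mevalC.
  by rewrite (nvar0_mpolyC p) /= mevalC.
apply: (@is_ufd_iso {poly {mpoly R[n]}} {mpoly R[n.+1]} (@of_uni n R) (@muni n R)).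
- exact: of_uniK.
- exact: muniK.
- exact: poly_is_ufd.
Qed.

(** * Prime ideals and residue fields *)

Lemma mul_repr_denom (R : idomainType) (x : {fraction R}) (r := generic_quotient.repr x) :
  x * FracField.tofrac (frac r).2 = FracField.tofrac (frac r).1.
Proof.
rewrite -[x]generic_quotient.reprK -/r; unlock FracField.tofrac.
rewrite -[LHS]FracField.pi_mul; apply/generic_quotient.eqmodP.
rewrite /= FracField.equivfE /FracField.mulf !numden_Ratio ?mulf_neq0 ?oner_neq0 ?denom_ratioP //.
by rewrite !mulr1 mulrC.
Qed.

Section Ideals.
Variable A : comNzRingType.

Record proper_ideal_of (I : A -> Prop) : Prop := ProperIdealOf {
  ideal0 : I 0;
  idealD : forall a b, I a -> I b -> I (a + b);
  idealM : forall a b, I b -> I (a * b);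
  ideal1 : ~ I 1 }.

Record prime_ideal := PrimeIdeal {
  pideal :> A -> Prop;
  pideal_proper : proper_ideal_of pideal;
  pideal_prime : forall a b, pideal (a * b) -> pideal a \/ pideal b }.

(** Zorn's lemma gives a maximal proper ideal [I] above [I0]. It is prime: if [a] is not in [I],
    then [I] and [a] generate 1, and multiplying by [b] puts [b] in [I]. *)
Lemma exists_prime_ideal (I0 : A -> Prop) : proper_ideal_of I0 ->
  exists P : prime_ideal, forall a, I0 a -> P a.
Proof.
move=> pI0; pose T := {I : A -> Prop | proper_ideal_of I /\ forall a, I0 a -> I a}.
pose le (I J : T) := boolp.asbool (forall a, sval I a -> sval J a).
have [||| tI maxI] :=
    @classical_sets.ZL_preorder T (exist _ I0 (conj pI0 (fun _ h => h))) le.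
- by move=> I; apply/boolp.asboolP.
- by move=> I J K /boolp.asboolP IJ /boolp.asboolP JK; apply/boolp.asboolP => a /IJ/JK.
- move=> C totC; case: (boolp.pselect (exists I, C I)) => [[I CI]|nC]; last first.
    exists (exist _ I0 (conj pI0 (fun _ h => h))) => J CJ; case: nC; by exists J.
  pose U a := exists2 J : T, C J & sval J a.
  have pU : proper_ideal_of U.
    split=> [|a b [J CJ Ja] [K CK Kb]|a b [J CJ Jb]|[J _ J1]].
    - by exists I => //; apply: ideal0; case: (svalP I).
    - case: (totC _ _ CJ CK) => /boolp.asboolP le_.
        by exists K => //; apply: idealD => //; [case: (svalP K)|apply: le_].
      by exists J => //; apply: idealD => //; [case: (svalP J)|apply: le_].
    - by exists J => //; apply: idealM => //; case: (svalP J).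
    - by case: (svalP J) => /ideal1.
  have sU a : I0 a -> U a by move=> Ia; exists I => //; case: (svalP I) => _; apply.
  exists (exist _ U (conj pU sU)) => J CJ; apply/boolp.asboolP => a Ja.
  by exists J.
case: (tI) maxI => I [pI sI] maxI.
have prI a b : I (a * b) -> I a \/ I b.
  move=> Iab; case: (boolp.pselect (I a)) => [|nIa]; first by left.
  right; pose J c := exists i x, I i /\ c = i + x * a.
  have IJ c : I c -> J c by move=> Ic; exists c, 0; rewrite mul0r addr0.
  case: (boolp.pselect (J 1)) => [[i [x [Ii def1]]]|nJ1].
    rewrite -[b]mul1r def1 mulrDl; apply: idealD => //; first by rewrite mulrC; apply: idealM.
    by rewrite -mulrA; apply: idealM.
  have pJ : proper_ideal_of J.
    split=> // [|c d [i [x [Ii ->]]] [j [y [Ij ->]]]|c d [i [x [Ii ->]]]].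
    - by apply: IJ; apply: ideal0.
    - by exists (i + j), (x + y); split; [apply: idealD|rewrite mulrDl addrACA].
    - by exists (c * i), (c * x); split; [apply: idealM|rewrite mulrDr mulrA].
  have sJ c : I0 c -> J c by move=> /sI/IJ.
  have /boolp.asboolP JI := maxI (exist _ J (conj pJ sJ)) (introT (boolp.asboolP _) IJ).
  by case: nIa; apply: JI; exists 0, 1; rewrite mul1r add0r; split=> //; apply: ideal0.
by exists (PrimeIdeal pI prI).
Qed.

Variable P : prime_ideal.

Definition pideal_pred : {pred A} := fun a => boolp.asbool (P a).

Lemma pideal_closed : idealr_closed pideal_pred.
Proof.
case: (pideal_proper P) => I0 ID IM I1.
split=> [||a u v /boolp.asboolP Pu /boolp.asboolP Pv]; first exact/boolp.asboolP.
  by apply/boolp.asboolPn.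
by apply/boolp.asboolP; apply: ID => //; apply: IM.
Qed.
HB.instance Definition _ := isIdealr.Build A pideal_pred pideal_closed.

Definition pquot := {ideal_quot pideal_pred}.
HB.instance Definition _ := GRing.ComNzRing.on pquot.
Definition to_pquot : A -> pquot := \pi_({ideal_quot pideal_pred})%qT.
HB.instance Definition _ := GRing.RMorphism.on to_pquot.

Lemma to_pquot_surj x : exists a, x = to_pquot a.
Proof. by exists (generic_quotient.repr x); rewrite /to_pquot generic_quotient.reprK. Qed.

Lemma to_pquot_eq0 a : to_pquot a = 0 <-> P a.
Proof.
rewrite -(rmorph0 to_pquot); split=> [/eqP|Pa].
  by rewrite -Quotient.idealrBE subr0 => /boolp.asboolP.
by apply/eqP; rewrite -Quotient.idealrBE subr0; apply/boolp.asboolP.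
Qed.

(** Units and inverses come from classical choice; they complete the integral domain structure whose
    fraction field is taken below. *)
Definition pquot_unit : {pred pquot} := fun x => boolp.asbool (exists y, y * x = 1).
Definition pquot_inv (x : pquot) : pquot :=
  if boolp.pselect (exists y, y * x = 1) is left h then sval (boolp.cid h) else x.

Lemma pquot_mulVr : {in pquot_unit, left_inverse 1 pquot_inv *%R}.
Proof.
move=> x /boolp.asboolP ux; rewrite /pquot_inv; case: boolp.pselect => // h.
exact: (svalP (boolp.cid h)).
Qed.
Lemma pquot_unitP (x y : pquot) : y * x = 1 -> pquot_unit x.
Proof. by move=> yx; apply/boolp.asboolP; exists y. Qed.
Lemma pquot_inv_out : {in [predC pquot_unit], pquot_inv =1 id}.
Proof.
move=> x /boolp.asboolPn ux; rewrite /pquot_inv; by case: boolp.pselect.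
Qed.
HB.instance Definition _ := GRing.ComNzRing_hasMulInverse.Build pquot
  pquot_mulVr pquot_unitP pquot_inv_out.

Lemma pquot_integral (x y : pquot) : x * y = 0 -> (x == 0) || (y == 0).
Proof.
have [[a ->] [b ->]] := (to_pquot_surj x, to_pquot_surj y).
rewrite -rmorphM => /to_pquot_eq0/pideal_prime[] /to_pquot_eq0->; by rewrite eqxx ?orbT.
Qed.
HB.instance Definition _ := GRing.ComUnitRing_isIntegral.Build pquot pquot_integral.

(** [K] is the residue field at [P], the fraction field of [A / P]. *)
Lemma prime_ideal_field : exists (K : fieldType) (f : {rmorphism A -> K}),
  (forall a, f a = 0 <-> P a) /\ (forall x, exists a b, f b != 0 /\ x = f a / f b).
Proof.
exists {fraction pquot}, (@FracField.tofrac pquot \o to_pquot); split=> [a|x] /=.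
  split=> [/eqP|Pa]; first by rewrite tofrac_eq0 => /eqP/to_pquot_eq0.
  by apply/eqP; rewrite tofrac_eq0; apply/eqP/to_pquot_eq0.
pose r := generic_quotient.repr x.
have [[a def_a] [b def_b]] := (to_pquot_surj (frac r).1, to_pquot_surj (frac r).2).
have nz_b : @FracField.tofrac pquot (to_pquot b) != 0 by rewrite tofrac_eq0 -def_b; case: (r).
exists a, b; split=> //.
by apply: (mulIf nz_b); rewrite divfK //= -def_a -def_b mul_repr_denom.
Qed.
End Ideals.

(** * Derivations *)

Section Derivations.
Variables (A S : comNzRingType).

(** A derivation of [A] into [S], where [S] is an [A]-module through [f]; with [f = idfun] it is an
    ordinary derivation. *)
Record deriv_along (f D : A -> S) : Prop := DerivAlong {
  along_add : forall a b, D (a + b) = D a + D b;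
  along_mul : forall a b, D (a * b) = D a * f b + f a * D b }.

Variables (f : {rmorphism A -> S}) (D : A -> S).
Hypothesis dD : deriv_along f D.

Lemma deriv_along0 : D 0 = 0.
Proof. by apply: (@addrI _ (D 0)); rewrite -(along_add dD) !addr0. Qed.

Lemma deriv_along1 : D 1 = 0.
Proof.
apply: (@addrI _ (D 1)); rewrite addr0.
by rewrite -[in RHS](mulr1 (1 : A)) (along_mul dD) rmorph1 mulr1 mul1r.
Qed.

Lemma deriv_along_opp a : D (- a) = - D a.
Proof. by apply: (@addrI _ (D a)); rewrite -(along_add dD) !subrr deriv_along0. Qed.

Lemma deriv_along_sum (I : Type) (r : seq I) (P : pred I) F :
  D (\sum_(i <- r | P i) F i) = \sum_(i <- r | P i) D (F i).
Proof.
apply: (big_morph D); [exact: (along_add dD)|exact: deriv_along0].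
Qed.

End Derivations.

Lemma deriv_along_lincomb (A S : comNzRingType) (f : A -> S) (I : finType)
    (D : I -> A -> S) (c : I -> S) :
  (forall i, deriv_along f (D i)) -> deriv_along f (fun a => \sum_i c i * D i a).
Proof.
move=> dD; split=> a b.
  by rewrite -big_split; apply: eq_bigr => i _; rewrite (along_add (dD i)) mulrDr.
rewrite mulr_suml mulr_sumr -big_split; apply: eq_bigr => i _ /=.
by rewrite (along_mul (dD i)) mulrDr !mulrA; congr (_ + _); rewrite mulrAC mulrC mulrA.
Qed.

(* Unlike for [map_mpoly], the map [d] need not carry an additive structure. *)
Definition map_coef (n : nat) (R : nzRingType) (d : R -> R) (p : {mpoly R[n]}) : {mpoly R[n]} :=
  \sum_(m <- msupp p) d p@_m *: 'X_[m].

Section ChainRule.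
Variables (n : nat) (R S T : comNzRingType) (h : {rmorphism R -> S}) (y : 'I_n -> S).
Variables (f : {rmorphism S -> T}) (D : S -> T) (d : R -> R).
Hypotheses (dD : deriv_along f D) (Dh : forall c, D (h c) = f (h (d c))).
Local Notation ev := (mmap h y).

Lemma chain_rule_monomial m :
  D (ev 'X_[m]) = \sum_i f (ev ('X_[m])^`M(i)) * D (y i).
Proof.
pose P p := D (ev p) = \sum_i f (ev p^`M(i)) * D (y i).
have P1 : P 1.
  rewrite /P rmorph1 (deriv_along1 dD) big1 // => i _.
  by rewrite -mpolyC1 mderivC !rmorph0 mul0r.
have PM p q : P p -> P q -> P (p * q).
  rewrite /P rmorphM (along_mul dD) => -> ->.
  rewrite mulr_suml mulr_sumr -big_split; apply: eq_bigr => i _ /=.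
  by rewrite mderivM !rmorphD !rmorphM /= mulrDl; congr (_ + _); [rewrite mulrAC|rewrite mulrA].
have PX i : P 'X_i.
  rewrite /P mmapX mmap1U (bigD1 i) //= mderivX mnm1E eqxx.
  rewrite [X in 'X_[X]](_ : _ = 0%MM); last first.
    by apply/mnmP=> j; rewrite !mnmE subnn.
  rewrite scale1r mpolyX0 !rmorph1 mul1r big1 ?addr0 // => j /negPf ne.
  by rewrite mderivX mnm1E eq_sym ne scale0r !rmorph0 mul0r.
rewrite -/(P 'X_[m]) mpolyXE_id; apply: big_ind => // i _.
by elim: (m i) => [|k IHk]; rewrite ?expr0 // exprS; apply: PM.
Qed.

(** Additivity reduces this to scaled monomials, where the product rule applies. The first term
    differentiates the coefficients of [p], the second its arguments. *)
Lemma chain_rule p :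
  D (ev p) = f (ev (map_coef d p)) + \sum_i f (ev p^`M(i)) * D (y i).
Proof.
rewrite {1}[p]mpolyE /map_coef !rmorph_sum (deriv_along_sum dD) /=.
transitivity (\sum_(m <- msupp p) (f (ev (d p@_m *: 'X_[m])) +
    \sum_i f (ev (p@_m *: 'X_[m])^`M(i)) * D (y i))).
  apply: eq_bigr => m _; rewrite !mmapZ (along_mul dD) Dh chain_rule_monomial rmorphM; congr (_ + _).
  rewrite mulr_sumr; apply: eq_bigr => i _.
  by rewrite mderivZ mmapZ rmorphM /= mulrA.
rewrite big_split /=; congr (_ + _); first by rewrite -?rmorph_sum.
rewrite exchange_big /=; apply: eq_bigr => i _.
have -> : p^`M(i) = \sum_(m <- msupp p) (p@_m *: 'X_[m])^`M(i).
  by rewrite {1}[p]mpolyE raddf_sum.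
by rewrite -mulr_suml (raddf_sum (mmap h y)) (raddf_sum f).
Qed.

End ChainRule.

Section FractionDerivation.
Variables (A : comNzRingType) (K : fieldType) (f : {rmorphism A -> K}) (D : A -> K).
Hypotheses (frac_f : forall x, exists a b, f b != 0 /\ x = f a / f b).
Hypotheses (dD : deriv_along f D) (D_ker : forall a, f a = 0 -> D a = 0).

(** The quotient rule defines [d]. By [D_ker] the value of [D] depends only on the image under [f],
    so the choice of fraction does not matter. *)
Lemma fraction_deriv : exists d : K -> K, deriv_along idfun d /\ forall a, d (f a) = D a.
Proof.
pose P x y := exists a b, [/\ f b != 0, x = f a / f b & y = (D a - x * D b) / f b].
have exP x : exists y, P x y.
  have [a [b [nz_b def_x]]] := frac_f x.
  by exists ((D a - x * D b) / f b), a, b.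
have uniqP x y z : P x y -> P x z -> y = z.
  move=> [a [b [nz_b def_x ->]]] [a' [b' [nz_b' def_x' ->]]].
  have fa : f a = x * f b by rewrite def_x divfK.
  have fa' : f a' = x * f b' by rewrite def_x' divfK.
  have : D (a * b' - a' * b) = 0.
    by apply: D_ker; rewrite rmorphB !rmorphM /= fa fa' mulrAC subrr.
  rewrite (along_add dD) (deriv_along_opp dD) !(along_mul dD) fa fa' => eq0.
  apply/eqP; rewrite eqr_div // -subr_eq0 -eq0; apply/eqP; ring.
pose d x := sval (boolp.cid (exP x)).
have dP x : P x (d x) by rewrite /d; case: boolp.cid.
have dE x y : P x y -> d x = y by apply: uniqP.
exists d; split; first split=> x y.
- have [[a [b [nz_b def_x ->]]] [a' [b' [nz_b' def_y ->]]]] := (dP x, dP y).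
  apply: dE; exists (a * b' + a' * b), (b * b'); rewrite rmorphM mulf_neq0 //; split=> //.
    by rewrite def_x def_y rmorphD !rmorphM /=; field; rewrite nz_b nz_b'.
  rewrite (along_add dD) !(along_mul dD).
  have fa : f a = x * f b by rewrite def_x divfK.
  have fa' : f a' = y * f b' by rewrite def_y divfK.
  by rewrite fa fa' /=; field; rewrite nz_b nz_b'.
- have [[a [b [nz_b def_x ->]]] [a' [b' [nz_b' def_y ->]]]] := (dP x, dP y).
  apply: dE; exists (a * a'), (b * b'); rewrite rmorphM mulf_neq0 //; split=> //.
    by rewrite def_x def_y !rmorphM /=; field; rewrite nz_b nz_b'.
  rewrite !(along_mul dD).
  have fa : f a = x * f b by rewrite def_x divfK.
  have fa' : f a' = y * f b' by rewrite def_y divfK.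
  by rewrite fa fa' /=; field; rewrite nz_b nz_b'.
- move=> a; apply: dE; exists a, 1; rewrite rmorph1 oner_neq0 divr1; split=> //.
  by rewrite (deriv_along1 dD) mulr0 subr0 divr1.
Qed.

End FractionDerivation.

(** * Order of vanishing and degree *)

Section VanishingOrder.
Variable R : idomainType.
Implicit Types f g : {poly R}.

(** The order of vanishing at t = 0 is at least [k], that is, ['X^k] divides [f]. *)
Definition vge k f := forall i, (i < k)%N -> f`_i = 0.

Lemma vge0 k : vge k (0 : {poly R}). Proof. by move=> i _; rewrite coef0. Qed.
Lemma vgeD k f g : vge k f -> vge k g -> vge k (f + g).
Proof. by move=> vf vg i lt_i; rewrite coefD vf // vg // addr0. Qed.
Lemma vgeN k f : vge k f -> vge k (- f).
Proof. by move=> vf i lt_i; rewrite coefN vf // oppr0. Qed.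
Lemma vgeB k f g : vge k f -> vge k g -> vge k (f - g).
Proof. by move=> vf vg; apply: vgeD => //; apply: vgeN. Qed.
Lemma vgeMl k f g : vge k g -> vge k (f * g).
Proof.
move=> vg i lt_i; rewrite coefM big1 // => j _; rewrite vg ?mulr0 //.
by apply: leq_ltn_trans lt_i; rewrite leq_subr.
Qed.
Lemma vge_sum k (I : Type) (r : seq I) (P : pred I) F :
  (forall i, P i -> vge k (F i)) -> vge k (\sum_(i <- r | P i) F i).
Proof. by move=> vF; apply: big_ind => //; [apply: vge0|apply: vgeD]. Qed.
Lemma vge_le k l f : (l <= k)%N -> vge k f -> vge l f.
Proof. by move=> le vf i lt_i; apply: vf; apply: leq_trans le. Qed.
Lemma vge_deriv k f : vge k f -> vge k.-1 f^`().
Proof. by case: k => // k vf i lt_i; rewrite coef_deriv vf ?mul0rn. Qed.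
Lemma vge_polyC c : vge 1 c%:P -> c = 0.
Proof. by move=> /(_ 0%N isT); rewrite coefC. Qed.

(** Over a domain orders add: if [f] and [g] have exact orders [i < a] and [j < b], the coefficient
    of [f * g] at [i + j < k] is the product of their lowest coefficients and is nonzero. *)
Lemma vgeM_prime k a b f g : (a + b <= k.+1)%N -> vge k (f * g) -> vge a f \/ vge b g.
Proof.
move=> le_ab vfg; case: (boolp.pselect (vge a f)) => [|nf]; first by left.
case: (boolp.pselect (vge b g)) => [|ng]; first by right.
have least c h : ~ vge c h -> exists i, [/\ (i < c)%N, h`_i != 0 & vge i h].
  move=> nh; have exi : exists i, (i < c)%N && (h`_i != 0).
    apply: boolp.contrapT => nex; apply: nh => i lt_i; apply/eqP/negPn/negP => nz.
    by apply: nex; exists i; rewrite lt_i.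
  case: (ex_minnP exi) => i /andP[lt_i nz_i] min_i; exists i; split=> // j lt_j.
  apply/eqP/negPn/negP => nz_j; have := min_i j; rewrite nz_j (ltn_trans lt_j) // => /(_ isT).
  by rewrite leqNgt lt_j.
have [[i [lt_i nz_i vi]] [j [lt_j nz_j vj]]] := (least _ _ nf, least _ _ ng).
have /eqP : (f * g)`_(i + j) = 0 by apply: vfg; lia.
rewrite coefM (bigD1 (inord i)) //= big1 ?addr0 => [|l].
  by rewrite inordK ?ltnS ?leq_addr // addKn mulf_eq0 (negPf nz_i) (negPf nz_j).
rewrite -val_eqE /= inordK ?ltnS ?leq_addr // => ne_l.
have [lt_l|lt_l|eq_l] := ltngtP l i; first by rewrite vi // mul0r.
  by rewrite vj ?mulr0 //; have := ltn_ord l; lia.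
by rewrite eq_l eqxx in ne_l.
Qed.

(** Each factor [f] has order less than [a], so removing it lowers the known order by at most
    [a]. *)
Lemma vge_expl k a d f g : ~ vge a f -> vge k (f ^+ d * g) -> vge (k - d * a) g.
Proof.
move=> nf; elim: d k => [|d IHd] k; first by rewrite expr0 mul1r mul0n subn0.
rewrite exprS -mulrA mulSn subnDA => vk; apply: IHd.
have [le_ak|lt_ka] := leqP a k; last first.
  by rewrite (_ : (k - a)%N = 0%N) => //; apply/eqP; rewrite subn_eq0 ltnW.
by case: (@vgeM_prime k a (k - a) f (f ^+ d * g) _ vk) => //; rewrite subnKC.
Qed.

End VanishingOrder.

Section Msize.
Variables (n : nat) (R : idomainType).
Implicit Types p q : {mpoly R[n]}.

(** [msize] is the degree plus one, and 0 at the zero polynomial. Bounds of the form [a.+1] make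
    degrees additive without excluding zero. *)
Lemma msizeM_bound p q a b : (msize p <= a.+1)%N -> (msize q <= b.+1)%N ->
  (msize (p * q) <= (a + b).+1)%N.
Proof.
have [->|nz_p] := eqVneq p 0; first by rewrite mul0r msize0.
have [->|nz_q] := eqVneq q 0; first by rewrite mulr0 msize0.
by rewrite msizeM //; lia.
Qed.

Lemma msize_exp_bound p a k : (msize p <= a.+1)%N -> (msize (p ^+ k) <= (k * a).+1)%N.
Proof.
move=> pa; elim: k => [|k IHk]; first by rewrite expr0 msize1.
by rewrite exprS mulSn; apply: msizeM_bound.
Qed.

Lemma msize_prod_bound (I : Type) (r : seq I) (P : pred I) (F : I -> {mpoly R[n]}) (a : I -> nat) :
  (forall i, P i -> (msize (F i) <= (a i).+1)%N) ->
  (msize (\prod_(i <- r | P i) F i)%R <= (\sum_(i <- r | P i) a i).+1)%N.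
Proof.
move=> le_a; elim: r => [|i r IHr]; first by rewrite !big_nil msize1.
by rewrite !big_cons; case: ifP => // Pi; apply: msizeM_bound => //; apply: le_a.
Qed.

Lemma msize_sum_bound (I : Type) (r : seq I) (P : pred I) (F : I -> {mpoly R[n]}) a :
  (forall i, P i -> (msize (F i) <= a)%N) -> (msize (\sum_(i <- r | P i) F i)%R <= a)%N.
Proof.
move=> le_a; apply: (big_ind (fun p : {mpoly R[n]} => (msize p <= a)%N)) => //.
  by rewrite msize0.
by move=> p q pa qa; apply: leq_trans (msizeD_le _ _) _; rewrite geq_max pa qa.
Qed.

Lemma msize_det k (A : 'M[{mpoly R[n]}]_k) a :
  (forall i j, (msize (A i j) <= a.+1)%N) -> (msize (\det A) <= (k * a).+1)%N.
Proof.
move=> le_a; rewrite /determinant; apply: msize_sum_bound => s _.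
rewrite -[(k * a)%N]add0n; apply: (@msizeM_bound _ _ 0%N (k * a)%N).
  by rewrite -signr_odd; case: (odd _); rewrite ?expr1 ?expr0 ?msizeN msize1.
have := @msize_prod_bound _ (index_enum 'I_k) predT (fun i => A i (s i)) (fun=> a).
by rewrite sum_nat_const card_ord; apply.
Qed.

Lemma msize_mderiv i p : (msize p^`M(i) <= (msize p).-1)%N.
Proof.
rewrite [X in (X <= _)%N]msizeE; apply/bigmax_leqP_seq => m; rewrite mcoeff_msupp mcoeff_deriv => nz _.
have : (m + U_(i))%MM \in msupp p.
  by rewrite mcoeff_msupp; apply: contraNneq nz => ->; rewrite mul0rn.
by move/msize_mdeg_lt; rewrite mdegD mdeg1; lia.
Qed.

Lemma msize_map_coef (d : R -> R) p : (msize (map_coef d p) <= msize p)%N.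
Proof.
rewrite /map_coef big_seq; apply: msize_sum_bound => m /msize_mdeg_lt lt_m.
by apply: leq_trans (msizeZ_le _ _) _; rewrite msizeX.
Qed.

Hypothesis char0 : forall k, k.+1%:R != 0 :> R.

Lemma mulrn_eq0 (x : R) k : x *+ k.+1 = 0 -> x = 0.
Proof. by move/eqP; rewrite -mulr_natr mulf_eq0 (negPf (char0 k)) orbF => /eqP. Qed.

(** Differentiation multiplies the coefficient at [m] by [m i], which in characteristic 0 is nonzero
    as soon as the variable occurs in [m]. *)
Lemma mderiv_eq0 i p : p^`M(i) = 0 -> forall m, m \in msupp p -> m i = 0%N.
Proof.
move=> dp m; rewrite mcoeff_msupp => nz; case def_k: (m i) => [//|k].
have /eqP := congr1 (mcoeff (m - U_(i))%MM) dp; rewrite mcoeff0 mcoeff_deriv.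
rewrite submK => [/eqP/mulrn_eq0/eqP|]; first by rewrite (negPf nz).
by rewrite lep1mP def_k.
Qed.

Lemma mderiv_eq0_const p : (forall i, p^`M(i) = 0) -> p = (p@_0)%:MP.
Proof.
move=> dp; apply/mpolyP => m; rewrite mcoeffC.
have [->|nz_m] := eqVneq m 0%MM; first by rewrite mulr1.
rewrite mulr0; apply/eqP; apply: contraNT nz_m; rewrite -mcoeff_msupp => m_p.
by apply/eqP/mnmP => i; rewrite mnm0E (mderiv_eq0 (dp i)).
Qed.

End Msize.

Section MsizeUni.
Variables (n : nat) (R : idomainType).
Implicit Types p q : {mpoly R[n.+1]}.

Lemma mdeg_widen (m : 'X_{1..n.+1}) :
  mdeg m = (mdeg [multinom m (widen_ord (leqnSn n) i) | i < n] + m ord_max)%N.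
Proof. by rewrite !mdegE big_ord_recr /=; congr (_ + _)%N; apply: eq_bigr => i _; rewrite mnmE. Qed.

Lemma size_muni p : (size (muni p) <= msize p)%N.
Proof.
rewrite muniE big_seq.
apply: (big_ind (fun f : {poly {mpoly R[n]}} => (size f <= msize p)%N))
  => [|f g le_f le_g|m /msize_mdeg_lt]; first by rewrite size_poly0.
  by apply: leq_trans (size_polyD _ _) _; rewrite geq_max le_f le_g.
rewrite mdeg_widen => lt_m; apply: leq_trans (size_scale_leq _ _) _.
by rewrite size_polyXn; lia.
Qed.

Lemma msize_coef_muni p k : (msize (muni p)`_k <= msize p)%N.
Proof.
rewrite muniE coef_sum big_seq; apply: msize_sum_bound => m /msize_mdeg_lt.
rewrite mdeg_widen coefZ coefXn => lt_m.
case: eqP => _; rewrite ?mulr1 ?mulr0 ?msize0 //.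
by apply: leq_trans (msizeZ_le _ _) _; rewrite msizeX; lia.
Qed.

(** The Sylvester matrix has at most [b + a] rows, and its entries have degree at most [b]. *)
Lemma msize_resultant p q a b : (msize p <= a.+1)%N -> (msize q <= b.+1)%N -> (a <= b)%N ->
  (msize (resultant (muni p) (muni q)) <= ((b + a) * b).+1)%N.
Proof.
move=> le_p le_q le_ab; rewrite /resultant.
set A := Sylvester_mx _ _.
have le_A i j : (msize (A i j) <= b.+1)%N.
  rewrite /A Sylvester_mxE; case: split => k; case: (k <= j)%N; rewrite ?mulr1n ?mulr0n ?msize0 //.
    by apply: leq_trans (msize_coef_muni _ _) (leq_trans le_p _); rewrite ltnS.
  exact: leq_trans (msize_coef_muni _ _) le_q.
apply: leq_trans (msize_det le_A) _; rewrite ltnS leq_mul2r; apply/orP; right.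
by apply: leq_add; rewrite -subn1 leq_subLR add1n; apply: leq_trans (size_muni _) _.
Qed.

End MsizeUni.

Section Homogenization.
Variables (N : nat) (R : idomainType) (m : nat) (w : 'I_N -> {mpoly R[m]}) (s : {mpoly R[m]}).

(* [s ^ d * q(w / s)] with denominators cleared. *)
Definition clear_denom (d : nat) (q : {mpoly R[N]}) : {mpoly R[m]} :=
  \sum_(e <- msupp q) q@_e *: (\prod_l w l ^+ e l * s ^+ (d - mdeg e)).

Lemma msize_clear_denom d q a : (forall l, (msize (w l) <= a.+1)%N) -> (msize s <= a.+1)%N ->
  (msize q <= d.+1)%N -> (msize (clear_denom d q) <= (d * a).+1)%N.
Proof.
move=> le_w le_s le_q; rewrite /clear_denom big_seq; apply: msize_sum_bound => e /msize_mdeg_lt lt_e.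
apply: leq_trans (msizeZ_le _ _) _.
rewrite -[d in (d * a)%N](@subnKC (mdeg e)); last by rewrite -ltnS (leq_trans lt_e).
rewrite mulnDl; apply: msizeM_bound; last exact: msize_exp_bound.
rewrite mdegE big_distrl /=.
by apply: msize_prod_bound => l _; apply: msize_exp_bound.
Qed.

(** Stated modulo an ideal [J] because it serves twice: with the zero ideal of a field, and with the
    multiples of a power of t. *)
Lemma clear_denom_cong (S : comNzRingType) (g : {rmorphism {mpoly R[m]} -> S}) (h : {rmorphism R -> S})
    (c : 'I_N -> S) (J : S -> Prop) d q :
  J 0 -> (forall a b, J a -> J b -> J (a + b)) -> (forall a b, J b -> J (a * b)) ->
  (forall x, g x%:MP = h x) -> (forall l, J (g (w l) - g s * c l)) -> (msize q <= d.+1)%N ->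
  J (g (clear_denom d q) - g s ^+ d * mmap h c q).
Proof.
move=> J0 JD JM gC Jw le_q.
have JMM a a' b b' : J (a - a') -> J (b - b') -> J (a * b - a' * b').
  move=> Ja Jb; have -> : a * b - a' * b' = b * (a - a') + a' * (b - b') by ring.
  by apply: JD; apply: JM.
have JX a a' k : J (a - a') -> J (a ^+ k - a' ^+ k).
  by move=> Ja; elim: k => [|k IHk]; rewrite ?expr0 ?subrr // !exprS; apply: JMM.
have Jprod (e : 'X_{1..N}) : J (g (\prod_l w l ^+ e l) - g s ^+ mdeg e * mmap1 c e).
  rewrite rmorph_prod mdegE expr_sum -big_split /=.
  elim/big_rec2: _ => [|l y1 y2 _]; first by rewrite subrr.
  apply: JMM; rewrite rmorphXn -exprMn; exact: JX.
rewrite /clear_denom rmorph_sum /mmap mulr_sumr -sumrB big_seq.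
apply: big_ind => // e /msize_mdeg_lt lt_e.
rewrite -mul_mpolyC !rmorphM gC rmorphXn /=.
rewrite -[d in g s ^+ d * _](@subnKC (mdeg e)); last by rewrite -ltnS (leq_trans lt_e).
rewrite exprD.
have -> : h q@_e * (g (\prod_l w l ^+ e l) * g s ^+ (d - mdeg e)) -
   g s ^+ mdeg e * g s ^+ (d - mdeg e) * (h q@_e * mmap1 c e) =
   h q@_e * g s ^+ (d - mdeg e) * (g (\prod_l w l ^+ e l) - g s ^+ mdeg e * mmap1 c e) by ring.
exact: JM.
Qed.

End Homogenization.

Section Coefficientwise.
Variables (R : comNzRingType) (d : R -> R).
Hypothesis dd : deriv_along idfun d.

(** The extension of [d] to polynomials that treats the variable t as a constant. *)
Definition cderiv (f : {poly R}) : {poly R} := \poly_(i < size f) d f`_i.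

Lemma coef_cderiv f i : (cderiv f)`_i = d f`_i.
Proof.
rewrite coef_poly; case: ltnP => // le_i; rewrite nth_default //.
by have /= -> := deriv_along0 dd.
Qed.

Lemma cderiv_along : deriv_along idfun cderiv.
Proof.
split=> f g; apply/polyP => i.
  by rewrite coefD !coef_cderiv coefD (along_add dd).
rewrite coefD !coef_cderiv !coefM (deriv_along_sum dd) -big_split.
by apply: eq_bigr => j _ /=; rewrite (along_mul dd) !coef_cderiv.
Qed.

Lemma cderivC c : cderiv c%:P = (d c)%:P.
Proof.
apply/polyP => i; rewrite coef_cderiv !coefC; case: eqP => // _.
by have /= -> := deriv_along0 dd.
Qed.

End Coefficientwise.

Lemma vge_cderiv (R : idomainType) (d : R -> R) k (f : {poly R}) :
  deriv_along idfun d -> vge k f -> vge k (cderiv d f).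
Proof.
move=> dd vf i lt_i; rewrite coef_cderiv // vf //.
by have /= -> := deriv_along0 dd.
Qed.

(** * Relations among linear forms *)

Lemma leq_pow4 D1 : ((D1 * D1 + D1).+1 <= D1.+1 ^ 4)%N.
Proof. by rewrite !expnS expn0; nia. Qed.

(** The left side bounds the resultant of polynomials of degrees [D1] and [D1 * D1 + D1]; this is
    the source of the fourth power between consecutive levels. *)
Lemma leq_pow4_mul D1 : (((D1 * D1 + D1 + D1) * (D1 * D1 + D1)).+1 <= D1.+1 ^ 4)%N.
Proof.
set X := (D1 * D1 + D1)%N.
have -> : (D1.+1 ^ 4 = (X + D1).+1 * (X + D1).+1)%N by rewrite !expnS expn0 /X; nia.
by nia.
Qed.

Section PrimeRelation.
Variables (R : idomainType) (r : nat) (y : 'I_r -> {poly R}) (th : {poly R}).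
Hypothesis char0 : forall k, k.+1%:R != 0 :> R.

Definition ext_point (i : 'I_r.+1) := if unlift ord_max i is Some j then y j else th.
Local Notation evy := (mmap (@polyC R) y).
Local Notation ev := (mmap (@polyC R) ext_point).

Lemma ext_point_max : ext_point ord_max = th.
Proof. by rewrite /ext_point unlift_none. Qed.

Lemma widen_lift (j : 'I_r) : widen_ord (leqnSn r) j = lift ord_max j.
Proof. by apply: val_inj; rewrite /= /bump leqNgt ltn_ord. Qed.

Lemma ext_point_widen j : ext_point (widen_ord (leqnSn r) j) = y j.
Proof. by rewrite widen_lift /ext_point liftK. Qed.

(** Factoring the evaluation through [muni] allows identities between univariate polynomials, such
    as the one for the resultant, to be evaluated. *)
Lemma ev_muni : exists psi : {rmorphism {poly {mpoly R[r]}} -> {poly R}},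
  (forall G, ev G = psi (muni G)) /\ (forall c, psi c%:P = evy c).
Proof.
pose psi := horner_morph (fun p => mulrC th (evy p)); exists psi.
split=> [G|c]; last exact: horner_morphC.
apply: (mpoly_rmorph_ext (phi := ev) (psi := psi \o @muni r R)) => [c|i] /=.
  by rewrite muniC /psi horner_morphC /= mmapC; apply: (esym (mmapC _ _ _)).
rewrite mmapX mmap1U; have [j ->|->] := unliftP ord_max i.
  by rewrite -widen_lift muni_widen /psi horner_morphC /= mmapX mmap1U ext_point_widen.
by rewrite muni_ord_max /psi horner_morphX ext_point_max.
Qed.

Variables (D1 D' L' rho : nat).
Hypotheses (D_big : (D1.+1 ^ 4 <= D')%N) (le_rho : (L' <= rho)%N).
Hypothesis indep : forall G : {mpoly R[r]}, (msize G <= D')%N -> vge L' (evy G) -> G = 0.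
Variable F : {mpoly R[r.+1]}.
Hypotheses (prF : is_prime F) (szF : (msize F <= D1.+1)%N) (vF : vge rho (ev F)).

(** Otherwise [F] would be a relation among the [y] alone, which [indep] excludes. *)
Lemma size_muni_prime : (1 < size (muni F))%N.
Proof.
rewrite ltnNge; apply/negP => /size1_polyC def_F; have [nzF _ _] := prF.
have : muni F != 0 by apply: contraNneq nzF => F0; rewrite -[F]muniK F0 rmorph0.
rewrite def_F polyC_eq0 => /eqP; apply; apply: indep.
  apply: leq_trans (msize_coef_muni _ _) (leq_trans szF _).
  by apply: leq_trans D_big; rewrite -{1}[D1.+1]expn1 leq_pexp2l.
by have [psi [evE psiC]] := ev_muni; apply: vge_le le_rho _; move: vF; rewrite evE def_F psiC coefC.
Qed.

(** The resultant of [F] and [G] in the last variable is a relation of admissible degree among the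
    [y], hence zero. So [F] and [G] share a factor of positive degree, and [F] is prime. *)
Lemma dvdr_of_vge G : (msize G <= (D1 * D1 + D1).+1)%N -> vge L' (ev G) -> dvdr F G.
Proof.
have [psi [evE psiC]] := ev_muni.
move=> szG vG; apply: boolp.contrapT => nFG; have [nzF nuF dvF] := prF.
(* If [G] does not involve the last variable, it is itself a relation among the [y], hence zero. *)
have [sG|sG] := leqP (size (muni G)) 1.
  case: nFG; have def_G := size1_polyC sG.
  suff G0 : (muni G)`_0 = 0 by rewrite -[G]muniK def_G G0 rmorph0; apply: dvdr0.
  apply: indep.
    apply: leq_trans (msize_coef_muni _ _) (leq_trans szG _).
    exact: leq_trans (leq_pow4 _) D_big.
  by move: vG; rewrite evE def_G psiC coefC.
have sF := size_muni_prime.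
have [[U V] _ /= def_res] := resultant_in_ideal sF sG.
have res0 : resultant (muni F) (muni G) = 0.
  apply: indep.
    apply: leq_trans (msize_resultant szF szG _) _; first exact: leq_addl.
    exact: leq_trans (leq_pow4_mul _) D_big.
  have psi_res : psi (resultant (muni F) (muni G))%:P = psi U * psi (muni F) + psi V * psi (muni G).
    rewrite def_res (rmorphD psi). by congr (_ + _); apply: (rmorphM psi).
  rewrite -psiC psi_res; apply: vgeD; apply: vgeMl; last by rewrite -evE.
  by rewrite -evE; apply: vge_le vF.
have /eqP := res0; rewrite resultant_eq0; set g := gcdp _ _ => sg.
have to_uni : is_prime (muni F).
  apply: (@is_prime_iso {mpoly R[r.+1]} {poly {mpoly R[r]}} (@muni r R) (@of_uni r R)) prF.
    exact: muniK.
  exact: of_uniK.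
have [nzF' _ dvF'] := to_uni.
have not_const c : c != 0 -> ~ dvdr (muni F) c%:P.
  move=> nz_c [q def_c]; have : size (c%:P) = size (q * muni F) by rewrite def_c.
  have nz_q : q != 0.
    by apply: contraNneq nz_c => q0; rewrite -polyC_eq0 def_c q0 mul0r.
  rewrite size_polyC nz_c size_mul //.
  by move: sF nz_q; rewrite -size_poly_eq0; move: (size q) (size (muni F)) => a b /=; lia.
case/Pdiv.Idomain.dvdpP: (dvdp_gcdl (muni F) (muni G)) => -[c h] /= nz_c.
rewrite -mul_polyC -/g => def_F.
have nzcF : c%:P * muni F != 0 by rewrite mulf_neq0 // polyC_eq0.
(* [F] cannot divide [h] for degree reasons, since [g] has positive degree. So it divides the gcd
   [g], hence a constant multiple of [G], and since it divides no nonzero constant it divides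
   [G]. *)
have /dvF'[[q def_h]|Fg] : dvdr (muni F) (h * g).
- by rewrite -def_F; apply: dvdr_mull; apply: dvdr_refl.
- have : size (c%:P * muni F) = size (h * g) by rewrite def_F.
  have [nzh nzg] : h != 0 /\ g != 0.
    by apply/andP; rewrite -negb_or -mulf_eq0 -def_F.
  have nzq : q != 0 by apply: contraNneq nzh => q0; rewrite def_h q0 mul0r.
  rewrite mul_polyC size_scale // size_mul // def_h size_mul //.
  move: sg nzq sF; rewrite -size_poly_eq0.
  by move: (size q) (size g) (size (muni F)) => a b d; lia.
case/Pdiv.Idomain.dvdpP: (dvdp_gcdr (muni F) (muni G)) => -[c' h'] /= nz_c'.
rewrite -mul_polyC -/g => def_G.
have /dvF'[/not_const//|] : dvdr (muni F) (c'%:P * muni G).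
  by rewrite def_G; apply: dvdr_mull.
by move/(@dvdr_iso {mpoly R[r.+1]} {poly {mpoly R[r]}} (@muni r R) (@of_uni r R) (@muniK r R)).
Qed.

Lemma mderiv_max_neq0 : F^`M(ord_max) != 0.
Proof.
apply: contraTneq size_muni_prime => dF0; rewrite -leqNgt.
rewrite muniE big_seq; apply: (big_ind (fun f : {poly {mpoly R[r]}} => (size f <= 1)%N)).
- by rewrite size_poly0.
- by move=> f g le_f le_g; apply: leq_trans (size_polyD _ _) _; rewrite geq_max le_f le_g.
- move=> m Fm; rewrite (mderiv_eq0 char0 dF0 Fm) expr0.
  by apply: leq_trans (size_scale_leq _ _) _; rewrite size_poly1.
Qed.

Lemma msize_mderiv_max : (msize F^`M(ord_max) <= D1)%N.
Proof. by apply: leq_trans (msize_mderiv _ _) _; rewrite -subn1 leq_subLR add1n. Qed.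

Lemma ndvdr_mderiv_max : ~ dvdr F F^`M(ord_max).
Proof.
case=> q def_q; have nz := mderiv_max_neq0; have [nzF _ _] := prF.
have nzq : q != 0 by apply: contraNneq nz => q0; rewrite def_q q0 mul0r.
have := msize_mderiv ord_max F; rewrite {1}def_q msizeM //.
by move: nzF nzq; rewrite -!msize_poly_eq0; lia.
Qed.

(** By degree [F] does not divide its derivative, so [dvdr_of_vge] bounds the order of that
    derivative at the point. Cancelling it later costs a controlled amount of order. *)
Lemma nvge_mderiv_max : ~ vge L' (ev F^`M(ord_max)).
Proof.
move=> vdF; apply: ndvdr_mderiv_max; apply: dvdr_of_vge vdF.
by apply: leq_trans msize_mderiv_max _; lia.
Qed.

End PrimeRelation.

(** * The generic point of the hypersurface [F = 0] and its derivations *)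

Section GenericPoint.
Variables (R : idomainType) (r N : nat) (p : 'I_N -> {poly R}).
Variables (A : 'I_r -> 'I_N -> R) (u : 'I_N -> R) (dv : 'I_N -> R -> R).
Hypothesis char0 : forall k, k.+1%:R != 0 :> R.
Hypothesis ddv : forall j, deriv_along idfun (dv j).
Hypothesis dvA : forall j i l, dv j (A i l) = 0.
Hypothesis dvu : forall j l, dv j (u l) = (l == j)%:R.
Hypothesis dvp : forall j l k, dv j (p l)`_k = 0.

Definition linform (a : 'I_N -> R) := \sum_l a l *: p l.
Local Notation y := (fun i => linform (A i)).
Local Notation th := (linform u).
Local Notation evx := (mmap (@polyC R) p).
Local Notation ev := (mmap (@polyC R) (ext_point y th)).

Lemma cderiv_form j a k : (cderiv (dv j) (linform a))`_k = \sum_l dv j (a l) * (p l)`_k.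
Proof.
rewrite coef_cderiv // coef_sum (deriv_along_sum (ddv j)); apply: eq_bigr => l _.
by rewrite coefZ (along_mul (ddv j)) dvp mulr0 addr0.
Qed.

Lemma ev_linear_relation i (s : {mpoly R[r.+1]}) (w : 'I_N -> {mpoly R[r.+1]}) :
  ev (s * 'X_(widen_ord (leqnSn r) i) - \sum_l (A i l)%:MP * w l) =
  \sum_l (A i l)%:P * - (ev (w l) - ev s * p l).
Proof.
rewrite rmorphB rmorphM rmorph_sum /= mmapX mmap1U ext_point_widen /linform mulr_sumr -sumrB.
apply: eq_bigr => l _; rewrite rmorphM /= mmapC /= -mul_polyC; ring.
Qed.

Variables (D1 D' L' rho : nat).
Hypotheses (D_big : (D1.+1 ^ 4 <= D')%N) (L'_gt0 : (0 < L')%N).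
Hypothesis rho_big : (L' * D1.+1 < rho)%N.
Hypothesis indep : forall G : {mpoly R[r]},
  (msize G <= D')%N -> vge L' (mmap (@polyC R) y G) -> G = 0.
Variable F : {mpoly R[r.+1]}.
Hypotheses (prF : is_prime F) (szF : (msize F <= D1.+1)%N) (vF : vge rho (ev F)).

Lemma le_L'_rho : (L' <= rho)%N.
Proof. by apply: leq_trans (ltnW rho_big); rewrite mulnS leq_addr. Qed.

(** [dv l] plays the partial derivative with respect to [u l], so this is - F_(u_l), acting on the
    coefficients of [F] only. *)
Definition wnum l : {mpoly R[r.+1]} := - map_coef (dv l) F.
Definition wden := F^`M(ord_max).

(** Differentiating [ev F] by [u l], coefficient by coefficient in t, preserves its order. In the
    chain rule the forms [y] contribute nothing and [th] contributes [p l]. *)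
Lemma wnum_cong l : vge rho (ev (wnum l) - ev wden * p l).
Proof.
have -> : ev (wnum l) - ev wden * p l = - cderiv (dv l) (ev F).
  have Dh c : cderiv (dv l) c%:P = idfun (dv l c)%:P by apply: cderivC.
  rewrite (chain_rule (ext_point y th) (cderiv_along (ddv l)) Dh) /=.
  rewrite /wnum rmorphN big_ord_recr /= big1 => [|i _]; last first.
    rewrite ext_point_widen (_ : cderiv _ _ = 0) ?mulr0 //.
    apply/polyP => k; rewrite cderiv_form coef0 big1 // => j _.
    by rewrite dvA mul0r.
  rewrite ext_point_max (_ : cderiv _ _ = p l) ?add0r ?opprD //.
  apply/polyP => k; rewrite cderiv_form (bigD1 l) //= big1 ?addr0 => [|j ne].
    by rewrite dvu eqxx mul1r.
  by rewrite dvu (negPf ne) mul0r.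
by apply: vgeN; apply: vge_cderiv.
Qed.

Lemma dvdr_of_vge_form G : (msize G <= (D1 * D1 + D1).+1)%N -> vge L' (ev G) -> dvdr F G.
Proof. exact: (dvdr_of_vge D_big le_L'_rho indep prF szF vF). Qed.

Lemma nvge_wden : ~ vge L' (ev wden).
Proof. exact: (nvge_mderiv_max char0 D_big le_L'_rho indep prF szF vF). Qed.

Lemma vge_of_dvdr G : dvdr F G -> vge rho (ev G).
Proof. by case=> H ->; rewrite rmorphM; apply: vgeMl. Qed.

Variables (E : fieldType) (f : {rmorphism {mpoly R[r.+1]} -> E}).
Hypothesis ker_f : forall G, f G = 0 <-> dvdr F G.
Hypothesis frac_f : forall x, exists a b, f b != 0 /\ x = f a / f b.

Definition basehom : {rmorphism R -> E} := f \o @mpolyC r.+1 R.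
Definition xi l := f (wnum l) / f wden.
Local Notation evE := (mmap basehom xi).

Lemma f_wden_neq0 : f wden != 0.
Proof.
apply/eqP => /ker_f dvF; apply: nvge_wden.
by apply: vge_le le_L'_rho _; apply: vge_of_dvdr.
Qed.

(** A constant in the kernel is a multiple of [F], so it vanishes to positive order and is 0. *)
Lemma basehom_inj c : basehom c = 0 -> c = 0.
Proof.
move=> ic0; have fc0 : f c%:MP = 0 by [].
have := vge_of_dvdr (proj1 (ker_f _) fc0); rewrite mmapC => vc; apply: vge_polyC.
by apply: vge_le vc; apply: leq_trans L'_gt0 le_L'_rho.
Qed.

Lemma msize_wnum l : (msize (wnum l) <= D1.+1)%N.
Proof. by rewrite msizeN; apply: leq_trans (msize_map_coef _ _) szF. Qed.

Lemma msize_wden : (msize wden <= D1)%N.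
Proof. exact: (msize_mderiv_max szF). Qed.

Lemma f_clear_denom q : (msize q <= D1.+1)%N ->
  f (clear_denom wnum wden D1 q) = f wden ^+ D1 * evE q.
Proof.
move=> szq; apply/eqP; rewrite -subr_eq0; apply/eqP.
apply: (@clear_denom_cong _ _ _ wnum wden E f basehom xi (fun x => x = 0)) => //.
- by move=> a b -> ->; rewrite addr0.
- by move=> a b ->; rewrite mulr0.
- by move=> l; rewrite /xi mulrC divfK ?f_wden_neq0 // subrr.
Qed.

Lemma ev_clear_denom q : (msize q <= D1.+1)%N ->
  vge rho (ev (clear_denom wnum wden D1 q) - ev wden ^+ D1 * evx q).
Proof.
move=> szq; apply: (@clear_denom_cong _ _ _ wnum wden _ ev (@polyC R) p (vge rho)) => //.
- exact: vge0.
- by move=> a b; apply: vgeD.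
- by move=> a b; apply: vgeMl.
- by move=> x; apply: mmapC.
- exact: wnum_cong.
Qed.

Lemma msize_clear q : (msize q <= D1.+1)%N ->
  (msize (clear_denom wnum wden D1 q) <= (D1 * D1 + D1).+1)%N.
Proof.
move=> szq; apply: leq_trans (msize_clear_denom (a := D1) _ _ szq) _.
- exact: msize_wnum.
- exact: leq_trans msize_wden _.
- by rewrite ltnS leq_addr.
Qed.

(** The numerator of q(xi), evaluated at the forms, agrees with [ev wden ^+ D1 * evx q] to order
    [rho], so it vanishes to order [L'] and is divisible by [F]. *)
Lemma evE_eq0 q : (msize q <= D1.+1)%N -> vge L' (evx q) -> evE q = 0.
Proof.
move=> szq vq; have /eqP := f_clear_denom szq.
suff /ker_f -> : dvdr F (clear_denom wnum wden D1 q).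
  by rewrite eq_sym mulf_eq0 expf_eq0 (negPf f_wden_neq0) andbF => /eqP.
apply: dvdr_of_vge_form; first exact: msize_clear.
rewrite -[ev _](subrK (ev wden ^+ D1 * evx q)); apply: vgeD; last exact: vgeMl.
by apply: vge_le le_L'_rho _; apply: ev_clear_denom.
Qed.

(** Now the numerator is a multiple of [F] and has order at least [rho]; cancelling the [D1] factors
    [wden] costs at most [D1 * L']. *)
Lemma vge_of_evE_eq0 q : (msize q <= D1.+1)%N -> evE q = 0 -> vge (rho - D1 * L') (evx q).
Proof.
move=> szq q0; apply: (vge_expl (f := ev wden)); first exact: nvge_wden.
rewrite -[X in vge _ X](subKr (ev (clear_denom wnum wden D1 q))); apply: vgeB.
  by apply: vge_of_dvdr; apply/ker_f; rewrite f_clear_denom // q0 mulr0.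
exact: ev_clear_denom.
Qed.

(** The variables [Y_i] are linear in the [xi l], so a derivation that kills the base and every
    [xi l] also kills them. *)
Lemma f_var i : f 'X_(widen_ord (leqnSn r) i) = \sum_l basehom (A i l) * xi l.
Proof.
set X := 'X_ _; pose G := wden * X - \sum_l (A i l)%:MP * wnum l.
have fG : f G = 0.
  apply/ker_f; apply: dvdr_of_vge_form.
    apply: leq_trans (msizeD_le _ _) _; rewrite geq_max msizeN.
    have le1 : (D1.+1 <= (D1 * D1 + D1).+1)%N by rewrite ltnS leq_addl.
    rewrite !(leq_trans _ le1) //.
      apply: msize_sum_bound => l _; rewrite -[D1]add0n; apply: msizeM_bound.
        by rewrite msizeC leq_b1.
      exact: msize_wnum.
    have nzX : X != 0 by rewrite -msize_poly_eq0 msizeX.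
    have nzw : wden != 0 by apply: contraNneq f_wden_neq0 => ->; rewrite rmorph0.
    by rewrite msizeM // msizeX mdeg1 addn2 ltnS; apply: msize_wden.
  apply: vge_le le_L'_rho _; rewrite /G ev_linear_relation.
  by apply: vge_sum => l _; apply: vgeMl; apply: vgeN; apply: wnum_cong.
apply: (mulfI f_wden_neq0); rewrite mulr_sumr -rmorphM.
move/eqP: fG; rewrite rmorphB subr_eq0 => /eqP ->; rewrite rmorph_sum; apply: eq_bigr => l _.
by rewrite rmorphM mulrCA /xi [f wden * _]mulrC divfK ?f_wden_neq0.
Qed.

(** The derivative along [Y_i], with the last variable treated as the implicit function of the
    others defined by [F = 0]. *)
Definition partial i (G : {mpoly R[r.+1]}) : E :=
  f G^`M(widen_ord (leqnSn r) i)
  - f F^`M(widen_ord (leqnSn r) i) / f wden * f G^`M(ord_max).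

Lemma partial_along i : deriv_along f (partial i).
Proof.
rewrite /partial; set c := f F^`M(_) / _; split=> G H; first by rewrite !mderivD !rmorphD /=; ring.
by rewrite !mderivM !rmorphD !rmorphM /=; ring.
Qed.

Lemma partial_ker i G : f G = 0 -> partial i G = 0.
Proof.
move=> /ker_f[H ->].
have fF0 : f F = 0 by apply/ker_f; apply: dvdr_refl.
rewrite (along_mul (partial_along i)) fF0 mulr0 add0r /partial -/wden.
by rewrite divfK ?f_wden_neq0 // subrr mulr0.
Qed.

Lemma exists_partials : exists d : 'I_r -> E -> E,
  [/\ forall i, deriv_along idfun (d i), forall i c, d i (basehom c) = 0 &
      forall i j, d i (f 'X_(widen_ord (leqnSn r) j)) = (j == i)%:R].
Proof.
have [d dP] := boolp.choice (fun i =>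
  fraction_deriv frac_f (partial_along i) (@partial_ker i)).
exists d; split=> [i|i c|i j]; first by case: (dP i).
  case: (dP i) => _ di; rewrite [basehom c]/= di /partial.
  by rewrite !mderivC rmorph0 mulr0 subr0.
case: (dP i) => _ ->; rewrite /partial !mderivX !mnm1E.
have -> : (widen_ord (leqnSn r) j == ord_max) = false by rewrite -val_eqE /= ltn_eqF.
rewrite scale0r rmorph0 mulr0 subr0 -val_eqE /= val_eqE; case: eqP => [->|_].
  rewrite scale1r [X in 'X_[X]](_ : _ = 0%MM) ?mpolyX0 ?rmorph1 //.
  by apply/mnmP => l; rewrite !mnmE subnn.
by rewrite scale0r rmorph0.
Qed.

Section KillingConstants.
Variable d : E -> E.
Hypotheses (dd : deriv_along idfun d) (d_base : forall c, d (basehom c) = 0).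

Lemma deriv_evE q : d (evE q) = \sum_l evE q^`M(l) * d (xi l).
Proof.
have Dh c : d (basehom c) = idfun (basehom 0) by rewrite d_base /= rmorph0.
rewrite (chain_rule xi dd Dh) /map_coef big1 ?rmorph0 ?add0r // => m _.
by rewrite scale0r.
Qed.

End KillingConstants.

(** In characteristic 0 this says that only variables in [S] occur; derivatives are the form in
    which the chain rule needs it. *)
Definition vars_in (S : {set 'I_N}) (q : {mpoly R[N]}) := forall j, j \notin S -> q^`M(j) = 0.

(** Algebraic independence of the [xi s] over the base, tested only up to degree [D1]. *)
Definition dfree (S : {set 'I_N}) := forall q,
  (msize q <= D1.+1)%N -> vars_in S q -> evE q = 0 -> q = 0.

Lemma dfree0 : dfree set0.
Proof.
move=> q szq vq; have -> : q = (q@_0)%:MP.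
  by apply: mderiv_eq0_const => // j; apply: vq; rewrite inE.
by rewrite mmapC => /basehom_inj ->.
Qed.

Lemma vars_in_mderiv S q j : vars_in S q -> vars_in S q^`M(j).
Proof. by move=> vq l nl; rewrite mderiv_comm vq ?mderiv0. Qed.

(* A relation of minimal degree involving [xi j] is separable in [xi j]. *)
Lemma minimal_relation S j : dfree S -> ~ dfree (j |: S) -> exists q,
  [/\ (msize q <= D1.+1)%N, vars_in (j |: S) q, evE q = 0 & evE q^`M(j) != 0].
Proof.
move=> freeS nfree.
pose P k := boolp.asbool (exists q, [/\ q != 0, msize q = k, (k <= D1.+1)%N,
  vars_in (j |: S) q & evE q = 0]).
have exP : exists k, P k.
  apply: boolp.contrapT => nex; apply: nfree => q szq vq q0; apply/eqP/negPn/negP => nzq.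
  by apply: nex; exists (msize q); apply/boolp.asboolP; exists q.
case: (ex_minnP exP) => k /boolp.asboolP[q [nzq szq le_k vq q0]] min_k.
exists q; split=> //; first by rewrite szq.
apply/eqP => dq0; have [dqj|nz_dq] := eqVneq q^`M(j) 0.
  case/eqP: nzq; apply: (freeS _ _ _ q0); first by rewrite szq.
  move=> l nl; have [->//|ne] := eqVneq l j.
  by apply: vq; rewrite !inE negb_or ne.
have lt_k : (msize q^`M(j) < k)%N.
  rewrite -szq; apply: leq_ltn_trans (msize_mderiv _ _) _.
  by rewrite prednK // lt0n msize_poly_eq0.
have /min_k : P (msize q^`M(j)); last by rewrite leqNgt lt_k.
apply/boolp.asboolP; exists q^`M(j); split=> //; last exact: vars_in_mderiv.
exact: leq_trans (ltnW lt_k) le_k.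
Qed.

Lemma maximal_dfree (T S0 : {set 'I_N}) : dfree S0 -> S0 \subset T ->
  exists S : {set 'I_N}, [/\ S0 \subset S, S \subset T, dfree S &
    forall j, j \in T -> j \notin S -> ~ dfree (j |: S)].
Proof.
move=> freeS0 sS0T; pose P (S : {set 'I_N}) := boolp.asbool (dfree S) && (S \subset T).
have PS0 : P S0 by rewrite /P sS0T andbT; apply/boolp.asboolP.
have [S /maxsetP[/andP[/boolp.asboolP freeS sST] maxS] sS0S] := maxset_exists PS0.
exists S; split=> // j Tj nSj freejS.
have jSS : j |: S = S.
  apply: maxS; last exact: subsetUr.
  by rewrite /P subUset sub1set Tj sST !andbT; apply/boolp.asboolP.
by case/negP: nSj; rewrite -jSS !inE eqxx.
Qed.

Hypothesis dependent_coords : forall S : {set 'I_N}, (r < #|S|)%N ->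
  exists q, [/\ q != 0, (msize q <= D1.+1)%N, vars_in S q & vge L' (evx q)].

Lemma card_dfree S : dfree S -> (#|S| <= r)%N.
Proof.
move=> freeS; rewrite leqNgt; apply/negP => /dependent_coords[q [nzq szq vq v0]].
by case/eqP: nzq; apply: freeS => //; apply: evE_eq0.
Qed.

(** Extend [S] to a maximal [S'], which has at most [r] elements. The matrix of the [r] partial
    derivations on the [xi s], [s] in [S'], has rank [r], so some combination of them takes any
    prescribed values there. *)
Lemma exists_derivation (S : {set 'I_N}) (z : 'I_N -> E) : dfree S ->
  exists d : E -> E, [/\ deriv_along idfun d, forall c, d (basehom c) = 0 &
    forall s, s \in S -> d (xi s) = z s].
Proof.
move=> freeS; have [S' [sSS' _ freeS' maxS']] := maximal_dfree freeS (subsetT S).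
have [d [dd d_base d_var]] := exists_partials.
pose comb (c : 'I_r -> E) := fun x => \sum_i c i * d i x.
have dcomb c : deriv_along idfun (comb c) by apply: deriv_along_lincomb.
have comb_base c a : comb c (basehom a) = 0.
  by rewrite /comb big1 // => i _; rewrite d_base mulr0.
pose M : 'M[E]_(r, #|S'|) := \matrix_(i, k) d i (xi (enum_val k)).
(* A combination killing [xi s] on [S'] kills every other [xi j] through its separable relation,
   hence every [Y_i] by [f_var]; its value at [Y_i] is its [i]-th coefficient. *)
have freeM : row_free M.
  apply/inj_row_free => c /matrixP cM0.
  have comb_xi j : comb (c 0) (xi j) = 0.
    have comb_S' s : s \in S' -> comb (c 0) (xi s) = 0.
      move=> S's; have := cM0 0 (enum_rank_in S's s); rewrite !mxE => cM.
      by rewrite -[RHS]cM; apply: eq_bigr => i _; rewrite mxE enum_rankK_in.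
    have [/comb_S' //|nS'j] := boolP (j \in S').
    have [q [szq vq q0 dq]] := minimal_relation freeS' (maxS' j (in_setT _) nS'j).
    have := deriv_evE (dcomb (c 0)) (comb_base (c 0)) q.
    rewrite q0 (deriv_along0 (dcomb (c 0))) (bigD1 j) //= big1 ?addr0 => [/eqP|l ne].
      by rewrite eq_sym mulf_eq0 (negPf dq) => /eqP.
    have [/comb_S' ->|nS'l] := boolP (l \in S'); first by rewrite mulr0.
    by rewrite vq ?rmorph0 ?mul0r // !inE negb_or ne.
  apply/rowP => i; rewrite mxE.
  have : comb (c 0) (f 'X_(widen_ord (leqnSn r) i)) = c 0 i.
    rewrite /comb (bigD1 i) //= d_var eqxx mulr1 big1 ?addr0 // => l ne.
    by rewrite d_var eq_sym (negPf ne) mulr0.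
  move <-; rewrite f_var (deriv_along_sum (dcomb _)) big1 // => l _.
  by rewrite (along_mul (dcomb _)) /= comb_base comb_xi mul0r mulr0 addr0.
have fullM : row_full M.
  rewrite /row_full eqn_leq rank_leq_col /=.
  by move: freeM; rewrite /row_free => /eqP ->; apply: card_dfree.
have /submxP[c def_c] := submx_full (\row_k z (enum_val k)) fullM.
exists (comb (c 0)); split=> // s Ss; have S's := subsetP sSS' s Ss.
have := congr1 (fun B : 'rV_ _ => B 0 (enum_rank_in S's s)) def_c.
rewrite !mxE enum_rankK_in // => ->; apply: eq_bigr => i _.
by rewrite mxE enum_rankK_in.
Qed.

Variable n : nat.
Hypothesis p_shift : forall l l' : 'I_N, l' = (l + n)%N :> nat -> (p l)^`() = p l'.

(** The derivation is prescribed on a maximal independent set [S] of coordinates whose shift exists.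
    For another such coordinate, differentiating its relation in t and by [d] gives the same linear
    equation. *)
Lemma exists_differential_point : exists d : E -> E,
  [/\ deriv_along idfun d, forall c, d (basehom c) = 0 &
    forall l l' : 'I_N, l' = (l + n)%N :> nat -> d (xi l) = xi l'].
Proof.
pose T : {set 'I_N} := [set l : 'I_N | (l + n < N)%N].
have [S [_ sST freeS maxS]] := maximal_dfree dfree0 (sub0set T).
(* The default value [l] outside [T] is harmless: the relation [q] below involves no variable
   outside [T]. *)
pose sh (l : 'I_N) := insubd l (l + n)%N.
have sh_val l : l \in T -> sh l = (l + n)%N :> nat by rewrite inE => lt_l; rewrite val_insubd lt_l.
have [d [dd d_base d_S]] := exists_derivation (fun s => xi (sh s)) freeS.
exists d; split=> // l l' def_l'.
have Tl : l \in T by rewrite inE -def_l'.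
have -> : l' = sh l by apply: val_inj; rewrite /= def_l' sh_val.
have [/d_S //|nSl] := boolP (l \in S).
have [q [szq vq q0 dq]] := minimal_relation freeS (maxS l Tl nSl).
have vqT k : k \notin T -> q^`M(k) = 0.
  move=> nTk; apply: vq; rewrite !inE negb_or; apply/andP; split.
    by apply: contraNneq nTk => ->.
  by apply: contra nTk; apply: (subsetP sST).
(* The total derivative of [q]; its degree does not exceed that of [q], as each term loses one
   degree and gains one variable. *)
pose Dq := \sum_k q^`M(k) * 'X_(sh k).
have evDq : evx Dq = (evx q)^`().
  have dp : deriv_along idfun (@deriv R).
    by split=> a b; rewrite ?derivD ?derivM.
  have Dh c : (@polyC R c)^`() = idfun (@polyC R 0) by rewrite derivC.
  rewrite (chain_rule p dp Dh) /map_coef big1 => [|m _]; last by rewrite scale0r.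
  rewrite !rmorph0 add0r rmorph_sum; apply: eq_bigr => k _ /=.
  rewrite rmorphM /= mmapX mmap1U; have [Tk|/vqT ->] := boolP (k \in T).
    by rewrite (p_shift (sh_val k Tk)).
  by rewrite rmorph0 !mul0r.
have szDq : (msize Dq <= D1.+1)%N.
  apply: msize_sum_bound => k _; have [->|nz] := eqVneq q^`M(k) 0; first by rewrite mul0r msize0.
  have nzX : 'X_(sh k) != 0 :> {mpoly R[N]} by rewrite -msize_poly_eq0 msizeX.
  rewrite msizeM // msizeX mdeg1 addn2 /=.
  by rewrite -[X in (_ < X)%N]prednK // ltnS; apply: leq_trans (msize_mderiv _ _) _;
    rewrite -subn1 leq_subLR add1n.
have Dq0 : evE Dq = 0.
  apply: evE_eq0 => //; rewrite evDq.
  (* By [rho_big], [rho - D1 * L'] is strictly greater than [L'], so order [L'] survives the loss of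
     one in differentiating. *)
  apply: vge_le (vge_deriv (vge_of_evE_eq0 szq q0)).
  move: rho_big; rewrite mulnS mulnC; move: (D1 * L')%N => a; lia.
have := deriv_evE dd d_base q; rewrite q0 (deriv_along0 dd) => sum0.
(* In this sum the terms on [S] vanish by the choice of [d], and those outside [l |: S] because [q]
   does not involve them; only the term at [l] remains. *)
have {sum0} : \sum_k evE q^`M(k) * (d (xi k) - xi (sh k)) = 0.
  under eq_bigr do rewrite mulrBr.
  rewrite sumrB -sum0 sub0r; apply/eqP; rewrite oppr_eq0 -[X in _ == X]Dq0 rmorph_sum.
  by apply/eqP; apply: eq_bigr => k _; rewrite rmorphM /= mmapX mmap1U.
rewrite (bigD1 l) //= big1 ?addr0 => [/eqP|k ne].
  by rewrite mulf_eq0 (negPf dq) subr_eq0 => /eqP.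
have [/d_S ->|nSk] := boolP (k \in S); first by rewrite subrr mulr0.
by rewrite vq ?rmorph0 ?mul0r // !inE negb_or ne.
Qed.

End GenericPoint.

Lemma mmap_ext (n : nat) (R S : nzRingType) (h : R -> S) (y z : 'I_n -> S) p :
  y =1 z -> mmap h y p = mmap h z p.
Proof.
by move=> eq_yz; apply: eq_bigr => m _; congr (_ * _); apply: eq_bigr => i _; rewrite eq_yz.
Qed.

(** If every prime factor had order less than [rho], the order of [F0] would be at most [rho] times
    its degree. *)
Lemma vge_prime_factor (R : idomainType) (m : nat) (z : 'I_m -> {poly R}) D1 rho (F0 : {mpoly R[m]}) :
  is_ufd R -> F0 != 0 -> (0 < rho)%N -> (msize F0 <= D1.+1)%N ->
  vge (rho * D1).+1 (mmap (@polyC R) z F0) ->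
  exists F, [/\ is_prime F, (msize F <= D1.+1)%N & vge rho (mmap (@polyC R) z F)].
Proof.
move=> ufdR nz0 rho0 sz0 v0; have [s pr_s [u uu def_F0]] := @mpoly_is_ufd m R ufdR _ nz0.
apply: boolp.contrapT => none.
have none_s F : F \in s -> (msize F <= D1.+1)%N -> ~ vge rho (mmap (@polyC R) z F).
  by move=> /pr_s prF szF vF; apply: none; exists F.
have nvC (G : {mpoly R[m]}) : G != 0 -> (msize G <= 1)%N -> ~ vge 1 (mmap (@polyC R) z G).
  move=> nzG szG; have def_G : G = (G@_0)%:MP.
    exact: msize1_polyC.
  rewrite def_G mmapC => /vge_polyC c0.
  by move: nzG; rewrite def_G c0 mpolyC0 eqxx.
have nz_u : u != 0 by apply: contraTneq uu => ->; rewrite unitr0.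
have sz_u : (msize u <= 1)%N.
  by case/andP: uu => /eqP -> _; rewrite msizeC leq_b1.
suff nv : ~ vge (rho * (msize F0).-1).+1 (mmap (@polyC R) z F0).
  apply: nv; apply: vge_le v0; rewrite ltnS leq_mul2l; apply/orP; right.
  by rewrite -subn1 leq_subLR add1n.
move: {v0} sz0; rewrite def_F0 {def_F0}; elim: s pr_s none_s {nz0} => [|F s IHs] pr_s none_s sz.
  rewrite big_nil mulr1 => vu; apply: (nvC u nz_u sz_u); apply: vge_le vu; exact: ltn0Sn.
have prF : is_prime F by apply: pr_s; rewrite inE eqxx.
have pr_s' G : G \in s -> is_prime G by move=> Gs; apply: pr_s; rewrite inE Gs orbT.
have [nzF _ _] := prF.
move: sz; rewrite big_cons mulrCA; set G := u * _ => sz.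
have nzG : G != 0.
  rewrite mulf_neq0 // prodf_seq_neq0; apply/allP => H /pr_s'[nzH _ _]; exact: nzH.
have szM := msizeM nzF nzG.
have sF : (0 < msize F)%N by rewrite lt0n msize_poly_eq0.
have sG : (0 < msize G)%N by rewrite lt0n msize_poly_eq0.
have szF : (msize F <= D1.+1)%N.
  by apply: leq_trans sz; rewrite szM -(prednK sG) addnS /= leq_addr.
have szG : (msize G <= D1.+1)%N.
  by apply: leq_trans sz; rewrite szM -(prednK sF) addSn /= leq_addl.
have none_s' H : H \in s -> (msize H <= D1.+1)%N -> ~ vge rho (mmap (@polyC R) z H).
  by move=> Hs; apply: none_s; rewrite inE Hs orbT.
have IH := IHs pr_s' none_s' szG.
rewrite szM (rmorphM (mmap (@polyC R) z)) => vFG.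
(* A factor of degree 0 evaluates to a nonzero constant of order 0, so such factors, however many,
   do not affect the count. *)
have [szF1|szF1] := leqP (msize F) 1.
  case: (@vgeM_prime _ _ 1 (rho * (msize G).-1).+1 _ _ _ vFG).
  - by move: sF sG szF1; move: (msize F) (msize G) => a b; nia.
  - exact: nvC.
  - exact: IH.
case: (@vgeM_prime _ _ rho (rho * (msize G).-1).+1 _ _ _ vFG).
- move: szF1 sG; move: (msize F) (msize G) => [|[|a]] // [|b] // _ _.
  by rewrite /= addnS /=; nia.
- by apply: none_s => //; rewrite inE eqxx.
- exact: IH.
Qed.

Section Renaming.
Variables (R : idomainType) (m N : nat) (J : 'I_m -> 'I_N).
Hypothesis injJ : injective J.

Definition rename : {mpoly R[m]} -> {mpoly R[N]} := mmap (@mpolyC N R) (fun s => 'X_(J s)).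
HB.instance Definition _ := GRing.RMorphism.on rename.

Lemma msize_rename G : (msize (rename G) <= msize G)%N.
Proof.
rewrite /rename /mmap big_seq; apply: msize_sum_bound => e /msize_mdeg_lt lt_e.
rewrite mul_mpolyC; apply: leq_trans (msizeZ_le _ _) _; apply: leq_trans lt_e.
rewrite mdegE; apply: msize_prod_bound => i _.
by rewrite mpolyXn msizeX mdegMn mdeg1 mul1n.
Qed.

Lemma rename_inj G : rename G = 0 -> G = 0.
Proof.
pose back : {mpoly R[N]} -> {mpoly R[m]} :=
  mmap (@mpolyC m R) (fun j => if [pick s | J s == j] is Some s then 'X_s else 0).
have backK : back (rename G) = G.
  apply: (mpoly_rmorph_ext (phi := back \o rename) (psi := idfun)) => [c|i] /=.
    by rewrite /rename mmapC /back mmapC.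
  rewrite /rename mmapX mmap1U /back mmapX mmap1U.
  by case: pickP => [s /eqP/injJ -> //|/(_ i)]; rewrite eqxx.
by move=> G0; rewrite -backK G0 /back rmorph0.
Qed.

Lemma mderiv_rename j G : (forall s, J s != j) -> (rename G)^`M(j) = 0.
Proof.
move=> neJ.
have dd : deriv_along idfun (@mderiv N R j) by split=> a b; rewrite ?mderivD ?mderivM.
have Dh c : (@mpolyC N R c)^`M(j) = idfun (@mpolyC N R 0) by rewrite mderivC mpolyC0.
rewrite /rename (chain_rule (fun s => 'X_(J s)) dd Dh) /map_coef big1 => [|e _]; last first.
  by rewrite scale0r.
rewrite !rmorph0 add0r big1 // => s _.
by rewrite mderivX mnm1E (negPf (neJ s)) scale0r mulr0.
Qed.

Lemma mmap_rename (S : comNzRingType) (h : {rmorphism R -> S}) (z : 'I_N -> S) G :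
  mmap h z (rename G) = mmap h (fun s => z (J s)) G.
Proof.
apply: (mpoly_rmorph_ext (phi := mmap h z \o rename) (psi := mmap h (fun s => z (J s)))) => [c|i] /=.
  by rewrite /rename mmapC !mmapC.
by rewrite /rename !mmapX !mmap1U mmapX mmap1U.
Qed.

End Renaming.

(** * The critical level of independence for a jet *)

Section Jets.
Variables (k : fieldType) (N n d0 : nat) (p : 'I_N -> {poly k}).
Hypothesis char0 : forall i, i.+1%:R != 0 :> k.
Hypothesis p_shift : forall l l' : 'I_N, l' = (l + n)%N :> nat -> (p l)^`() = p l'.
Hypothesis d0_gt1 : (1 < d0)%N.

(** The entries of [N.+1] generic linear forms are adjoined: at most [N] forms are in use at the
    critical level, so a fresh one remains. *)
Definition coefs := {mpoly k[N.+1 * N]}.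
HB.instance Definition _ := GRing.IntegralDomain.on coefs.
Definition cst : k -> coefs := @mpolyC (N.+1 * N) k.
HB.instance Definition _ := GRing.RMorphism.on cst.
Definition uvar (i : 'I_N.+1) (l : 'I_N) : coefs := 'X_(mxvec_index i l).
Definition pt l : {poly coefs} := map_poly cst (p l).

(* A linear form is either a coordinate or one of the generic forms. *)
Definition form_index := ('I_N + 'I_N.+1)%type.
Definition form_coef (b : form_index) (l : 'I_N) : coefs :=
  match b with inl j => (l == j)%:R | inr i => uvar i l end.

Definition deg_bound r := (d0 ^ (4 ^ (N.+1 - r)))%N.
(** One factor [deg_bound r] pays for cancelling powers of the derivative of [F], the other for
    passing to a prime factor. *)
Fixpoint ord_bound r := if r is r'.+1 then (ord_bound r' * deg_bound r ^ 2)%N else 1%N.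

Definition point_of r (a : 'I_r -> form_index) s := linform pt (form_coef (a s)).
(** Tuples may mix coordinates and generic forms, because dependence at the next level is applied
    both to a fresh generic form and to sets of coordinates. *)
Definition independent r (a : 'I_r -> form_index) := forall G : {mpoly coefs[r]},
  (msize G <= deg_bound r)%N -> vge (ord_bound r) (mmap (@polyC coefs) (point_of a) G) -> G = 0.

Lemma deg_bound_step r : (r <= N)%N -> (deg_bound r.+1 ^ 4)%N = deg_bound r.
Proof.
move=> le_r; rewrite /deg_bound -expnM; congr (_ ^ _)%N.
by rewrite -expnSr; congr (_ ^ _)%N; rewrite subSS subSn.
Qed.

Lemma deg_bound_gt0 r : (0 < deg_bound r)%N.
Proof. by rewrite expn_gt0 (ltn_trans _ d0_gt1). Qed.

Lemma deg_bound_ge r : (d0 <= deg_bound r)%N.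
Proof. by rewrite -{1}[d0]expn1 leq_pexp2l ?expn_gt0 // (ltn_trans _ d0_gt1). Qed.

Lemma deg_bound_le r : (deg_bound r <= deg_bound 0)%N.
Proof.
by rewrite leq_pexp2l ?(ltn_trans _ d0_gt1) // leq_pexp2l // subn0 leq_subr.
Qed.

Lemma ord_bound_gt0 r : (0 < ord_bound r)%N.
Proof. by elim: r => //= r IHr; rewrite muln_gt0 IHr expn_gt0 deg_bound_gt0. Qed.

Lemma ord_bound_le r : (ord_bound r <= deg_bound 0 ^ (2 * r))%N.
Proof.
elim: r => [|r IHr] //=.
rewrite mulnS addnC expnD leq_mul // leq_exp2r // deg_bound_le //.
Qed.

Lemma independent0 : exists a : 'I_0 -> form_index, independent a.
Proof.
exists (fun=> inr ord0) => G _; rewrite (nvar0_mpolyC G) mmapC => /vge_polyC ->.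
exact: mpolyC0.
Qed.

(** [N.+1] linear forms in [N] coordinates satisfy a linear relation, of admissible degree since
    [1 < d0]. *)
Lemma dependent_all (a : 'I_N.+1 -> form_index) : ~ independent a.
Proof.
(* A zero last column makes the coefficient matrix square, so that its determinant vanishes. *)
pose M : 'M[coefs]_N.+1 := \matrix_(s, t) if unlift ord_max t is Some l then form_coef (a s) l else 0.
have detM : \det M = 0.
  by rewrite (expand_det_col M ord_max) big1 // => s _; rewrite mxE unlift_none mul0r.
have [v nzv vM] : exists2 v : 'rV_N.+1, v != 0 & v *m M = 0 by apply/det0P; rewrite detM.
move=> indep; case/eqP: nzv; apply/rowP => s; rewrite mxE.
pose G : {mpoly coefs[N.+1]} := \sum_s v 0 s *: 'X_s.
have G0 : G = 0.
  apply: indep.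
    apply: leq_trans (deg_bound_ge _); apply: leq_trans d0_gt1.
    apply: msize_sum_bound => t _; apply: leq_trans (msizeZ_le _ _) _.
    by rewrite msizeX mdeg1.
  rewrite (_ : mmap _ _ _ = 0); first exact: vge0.
  rewrite /G rmorph_sum /=.
  transitivity (\sum_l (\sum_t v 0 t * form_coef (a t) l) *: pt l); last first.
    apply: big1 => l _; have /matrixP/(_ 0 (lift ord_max l)) := vM.
    rewrite !mxE => e; rewrite [X in X *: _](_ : _ = 0) ?scale0r // -[RHS]e.
    by apply: eq_bigr => t _; rewrite mxE liftK.
  under [RHS]eq_bigr do rewrite scaler_suml.
  rewrite exchange_big; apply: eq_bigr => t _ /=.
  rewrite mmapZ mmapX mmap1U /point_of /linform mul_polyC scaler_sumr.
  by apply: eq_bigr => l _; rewrite scalerA.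
have := congr1 (mcoeff U_(s)) G0; rewrite mcoeff0 raddf_sum /= (bigD1 s) //= big1 => [|t ne].
  by rewrite mcoeffZ mcoeffXU eqxx mulr1 addr0.
by rewrite mcoeffZ mcoeffXU (negPf ne) mulr0.
Qed.

(** Independence holds at level 0 and fails at level [N.+1], so it is lost between two consecutive
    levels. *)
Lemma critical_level : exists r, (r <= N)%N /\
  (exists a : 'I_r -> form_index, independent a) /\
  (forall b : 'I_r.+1 -> form_index, ~ independent b).
Proof.
apply: boolp.contrapT => none.
have all_r r : (r <= N.+1)%N -> exists a : 'I_r -> form_index, independent a.
  elim: r => [|r IHr] le_r; first exact: independent0.
  apply: boolp.contrapT => nex; apply: none; exists r; split=> //; split; first exact/IHr/ltnW.
  by move=> b ind_b; apply: nex; exists b.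
by have [a /dependent_all] := all_r N.+1 (leqnn _).
Qed.

Lemma fresh_index r (a : 'I_r -> form_index) : (r <= N)%N -> exists i, forall s, a s != inr i.
Proof.
move=> le_r; apply: boolp.contrapT => none.
have hit i : exists s, a s = inr i.
  apply: boolp.contrapT => nhit; apply: none; exists i => s.
  by apply/eqP => as_i; apply: nhit; exists s.
have [g gP] := boolp.choice hit.
have inj_g : injective g by move=> i j eq_g; have := gP i; rewrite eq_g gP => -[].
by have := leq_card g inj_g; rewrite !card_ord leqNgt ltnS le_r.
Qed.

Lemma mxvec_index_inj (i i' : 'I_N.+1) (l l' : 'I_N) :
  mxvec_index i l = mxvec_index i' l' -> i = i' /\ l = l'.
Proof. by move=> /cast_ord_inj/enum_rank_inj[-> ->]. Qed.

Lemma mderiv_along j : deriv_along idfun (fun c : coefs => c^`M(j)).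
Proof. by split=> a b; rewrite ?mderivD ?mderivM. Qed.

Lemma mderiv_natr j c : (c%:R : coefs)^`M(j) = 0.
Proof. by rewrite mderivMn -mpolyC1 mderivC mul0rn. Qed.

Lemma mderiv_uvar i l j : (uvar i l)^`M(mxvec_index i j) = (l == j)%:R.
Proof.
rewrite /uvar mderivX mnm1E; case: (eqVneq l j) => [->|ne].
  rewrite eqxx scale1r [X in 'X_[X]](_ : _ = 0%MM) ?mpolyX0 //.
  by apply/mnmP => t; rewrite !mnmE subnn.
by case: eqP => [/mxvec_index_inj[_ /eqP]|_]; rewrite ?(negPf ne) // scale0r.
Qed.

Lemma mderiv_form_coef i j b l : b != inr i -> (form_coef b l)^`M(mxvec_index i j) = 0.
Proof.
case: b => [j'|i'] /=; first by rewrite mderiv_natr.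
move=> ne; rewrite /uvar mderivX mnm1E; case: eqP => [/mxvec_index_inj[eq_i _]|_].
  by rewrite eq_i eqxx in ne.
by rewrite scale0r.
Qed.

Lemma linform_inl j : linform pt (form_coef (inl j)) = pt j.
Proof.
rewrite /linform (bigD1 j) //= eqxx scale1r big1 ?addr0 // => l /negPf ->.
by rewrite scale0r.
Qed.

Lemma coefs_ufd : is_ufd coefs.
Proof. exact: (@mpoly_is_ufd _ k (@field_is_ufd k)). Qed.

Lemma coefs_char0 i : i.+1%:R != 0 :> coefs.
Proof. by rewrite -mpolyC1 -mpolyCMn mpolyC_eq0. Qed.

Lemma pt_shift (l l' : 'I_N) : l' = (l + n)%N :> nat -> (pt l)^`() = pt l'.
Proof. by rewrite /pt => /p_shift <-; rewrite deriv_map. Qed.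

Lemma differential_point_of_jet : exists (E : fieldType) (h : {rmorphism k -> E})
    (d : E -> E) (x : 'I_N -> E),
  [/\ deriv_along idfun d, forall c, d (h c) = 0,
      forall l l' : 'I_N, l' = (l + n)%N :> nat -> d (x l) = x l' &
      forall q : {mpoly k[N]}, (msize q <= d0)%N ->
        vge (deg_bound 0 ^ (2 * N.+1)) (mmap (@polyC k) p q) -> mmap h x q = 0].
Proof.
have [r [le_r [[a ind_a] dep]]] := critical_level.
have [i0 fresh] := fresh_index a le_r.
(* [rho] is the least order allowed by [rho_big]; [ord_bound r.+1] is large enough for a prime
   factor to keep it. *)
pose D1 := (deg_bound r.+1).-1; pose L' := ord_bound r; pose rho := (L' * D1.+1).+1.
have def_D1 : D1.+1 = deg_bound r.+1 by rewrite prednK // deg_bound_gt0.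
have L'_gt0 : (0 < L')%N := ord_bound_gt0 r.
have le_ord : ((rho * D1).+1 <= ord_bound r.+1)%N.
  by rewrite /= -def_D1 -/L' /rho; move: L'_gt0; clearbody D1 L'; rewrite -mulnn; nia.
have dependent_tuple (b : 'I_r.+1 -> form_index) : exists G : {mpoly coefs[r.+1]},
    [/\ G != 0, (msize G <= D1.+1)%N & vge (rho * D1).+1 (mmap (@polyC coefs) (point_of b) G)].
  apply: boolp.contrapT => none; apply: (dep b) => G szG vG; apply/eqP/negPn/negP => nzG.
  by apply: none; exists G; rewrite def_D1; split=> //; apply: vge_le vG.
pose A s := form_coef (a s); pose u := form_coef (inr i0).
pose z := ext_point (fun s => linform pt (A s)) (linform pt u).
pose b s := if unlift ord_max s is Some j then a j else inr i0.
have [F0 [nzF0 szF0 vF0]] := dependent_tuple b.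
have [|F [prF szF vF]] := @vge_prime_factor coefs r.+1 z D1 rho F0 coefs_ufd nzF0 (ltn0Sn _) szF0.
  rewrite (@mmap_ext _ _ _ _ z (point_of b)) // => s.
  by rewrite /z /ext_point /point_of /b; case: unlift.
have primeI : proper_ideal_of (dvdr F).
  split.
  - exact: dvdr0.
  - by move=> x y; apply: dvdrD.
  - by move=> x y; apply: dvdr_mull.
  - by case: prF => _ /negP nu _ F1; apply: nu; apply: dvdr_unit F1; apply: unitr1.
have [_ _ dvF] := prF.
have [E [f [ker_f frac_f]]] := prime_ideal_field (PrimeIdeal primeI dvF).
(* Dependence at level [r.+1] is applied to [r.+1] coordinates chosen in [S], and the relation is
   renamed into their variables. *)
have dep_coords (S : {set 'I_N}) : (r < #|S|)%N -> exists q : {mpoly coefs[N]},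
    [/\ q != 0, (msize q <= D1.+1)%N, vars_in S q & vge L' (mmap (@polyC coefs) pt q)].
  move=> lt_r; pose J (s : 'I_r.+1) := enum_val (widen_ord lt_r s).
  have injJ : injective J.
    by move=> s t /enum_val_inj eq_st; apply: val_inj; apply: (congr1 val eq_st).
  have [G [nzG szG vG]] := dependent_tuple (fun s => inl (J s)).
  exists (rename J G); split.
  - by apply: contraNneq nzG => /(rename_inj injJ) ->.
  - by apply: leq_trans (msize_rename _ _) szG.
  - move=> j nSj; apply: mderiv_rename => s; apply: contraNneq nSj => <-.
    exact: enum_valP.
  - rewrite mmap_rename; apply: vge_le (_ : vge (rho * D1).+1 _).
      have : (0 < D1)%N by rewrite -ltnS def_D1 (leq_trans d0_gt1) // deg_bound_ge.
      by rewrite /rho; clearbody D1 L'; nia.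
    rewrite (@mmap_ext _ _ _ _ _ (point_of (fun s => inl (J s)))) // => s.
    by rewrite /point_of linform_inl.
have ddv j : deriv_along idfun (fun c : coefs => c^`M(mxvec_index i0 j)) by apply: mderiv_along.
have dvA j s l : (A s l)^`M(mxvec_index i0 j) = 0 by apply: mderiv_form_coef.
have dvu j l : (u l)^`M(mxvec_index i0 j) = (l == j)%:R by apply: mderiv_uvar.
have dvp j l i : ((pt l)`_i)^`M(mxvec_index i0 j) = 0 by rewrite coef_map mderivC.
have D_big : (D1.+1 ^ 4 <= deg_bound r)%N by rewrite def_D1 deg_bound_step.
have rho_big : (L' * D1.+1 < rho)%N by [].
have [d [dd d_h d_x]] := @exists_differential_point coefs r N pt A u _ coefs_char0 ddv
  dvA dvu dvp D1 (deg_bound r) L' rho D_big L'_gt0 rho_big ind_a F prF szF vF E f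
  ker_f frac_f dep_coords n pt_shift.
pose x := xi (fun j (c : coefs) => c^`M(mxvec_index i0 j)) F f.
exists E, (basehom f \o cst), d, x; split=> // [c|q szq vq]; first exact: d_h.
have := @evE_eq0 coefs r N pt A u _ coefs_char0 ddv
  dvA dvu dvp D1 (deg_bound r) L' rho D_big rho_big ind_a F prF szF vF E f ker_f (map_mpoly cst q).
have -> : mmap (basehom f) x (map_mpoly cst q) = mmap (basehom f \o cst) x q.
  apply: (mpoly_rmorph_ext (phi := mmap (basehom f) x \o map_mpoly cst)
    (psi := mmap (basehom f \o cst) x)) => [c|i] /=; first by rewrite map_mpolyC !mmapC.
  by rewrite map_mpolyX !mmapX !mmap1U.
apply.
- rewrite def_D1; apply: leq_trans (deg_bound_ge _); apply: leq_trans szq.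
  rewrite /map_mpoly /mmap big_seq; apply: msize_sum_bound => e /msize_mdeg_lt lt_e.
  rewrite mul_mpolyC; apply: leq_trans (msizeZ_le _ _) _.
  by rewrite /mmap1 -mpolyXE_id msizeX.
- have -> : mmap (@polyC coefs) pt (map_mpoly cst q) = map_poly cst (mmap (@polyC k) p q).
    apply: (mpoly_rmorph_ext (phi := mmap (@polyC coefs) pt \o map_mpoly cst)
      (psi := map_poly cst \o mmap (@polyC k) p)) => [c|i] /=.
      by rewrite map_mpolyC !mmapC map_polyC.
    by rewrite map_mpolyX !mmapX !mmap1U.
  move=> i lt_i; rewrite coef_map vq ?rmorph0 //.
  apply: leq_trans lt_i (leq_trans (ord_bound_le _) _).
  by rewrite leq_pexp2l ?deg_bound_gt0 // leq_mul2l /= ltnW.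
Qed.

End Jets.

(** * Jets of solutions *)

Section DifferentialEvaluation.
Variables (C : fieldType) (S : comNzRingType) (h : {rmorphism C -> S}) (d : S -> S).
Variables (n : nat) (x : nat -> S).
Hypotheses (dd : deriv_along idfun d) (d_h : forall c, d (h c) = 0).
Hypothesis d_x : forall v, d (x v) = x (n + v)%N.

Definition jet_eval K (g : {mpoly C[K]}) : S := mmap h (fun v : 'I_K => x v) g.

Lemma jet_eval_liftP K K' (g : {mpoly C[K]}) : (K <= K')%N ->
  jet_eval (liftP K' g) = jet_eval g.
Proof.
move=> leK; rewrite /jet_eval /liftP; set lq := mktuple _.
apply: (mpoly_rmorph_ext (phi := mmap h (fun v : 'I_K' => x v) \o comp_mpoly lq)
  (psi := mmap h (fun v : 'I_K => x v))) => [c|v] /=; first by rewrite comp_mpolyC !mmapC.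
have ltv : (v < K')%N by apply: leq_trans leK.
by rewrite comp_mpolyXU -tnth_nth tnth_mktuple /liftv insubT !mmapX !mmap1U.
Qed.

Lemma jet_eval_dervP K (g : {mpoly C[K]}) : jet_eval (dervP n g) = d (jet_eval g).
Proof.
have Dh c : d (h c) = idfun (h 0) by rewrite d_h /= rmorph0.
rewrite /jet_eval (chain_rule _ dd Dh) /map_coef big1 => [|m _]; last by rewrite scale0r.
rewrite !rmorph0 add0r /dervP (raddf_sum (mmap h _)); apply: eq_bigr => v _ /=.
rewrite rmorphM /= mmapX mmap1U d_x; congr (_ * _).
by apply: jet_eval_liftP; apply: leq_addl.
Qed.

Lemma jet_eval_dder m j (g : {mpoly C[m]}) : jet_eval (dder n j g) = iter j d (jet_eval g).
Proof. by elim: j => //= j <-; apply: jet_eval_dervP. Qed.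

Lemma leq_lvl m i j : (i <= j)%N -> (lvl n m i <= lvl n m j)%N.
Proof.
elim: j => [|j IHj]; first by case: i.
by rewrite leq_eqVlt => /orP[/eqP->//|/IHj/leq_trans]; apply; apply: leq_addl.
Qed.

(** Evaluation at a solution turns [dervP] into [d], so all derivatives of the [f i] vanish there
    and an identity for 1 would read 0 = 1. *)
Lemma solution_not_one_in_diff_ideal m s (f : 'I_s -> {mpoly C[m]}) :
  (forall i, jet_eval (f i) = 0) -> ~ one_in_diff_ideal n f.
Proof.
move=> f0 [L [K [leK [cs sum1]]]]; have := congr1 (@jet_eval K) sum1.
rewrite /jet_eval rmorph1 rmorph_sum big1 => [/esym/eqP|i _]; first by rewrite oner_eq0.
rewrite rmorphM /= [X in _ * X](_ : _ = 0) ?mulr0 //.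
have /flattenP[_ /mapP[j j_L ->]] : (ders n f L K)`_i \in ders n f L K by apply: mem_nth.
case/mapP=> t _ ->; move: j_L; rewrite mem_iota ltnS => /= le_j.
rewrite -[mmap _ _ _]/(jet_eval _) jet_eval_liftP; last exact: leq_trans (leq_lvl _ le_j) leK.
rewrite jet_eval_dder f0; elim: (j) => //= j' ->.
by apply: (deriv_along0 dd).
Qed.

End DifferentialEvaluation.

(** A common zero over some extension field is enough, so a prime ideal above [gs] serves in place
    of the Nullstellensatz. *)
Lemma exists_residue_field (A : comNzRingType) (gs : seq A) :
  ~ (exists cs : seq A, \sum_(i < size gs) cs`_i * gs`_i = 1) ->
  exists (K : fieldType) (f : {rmorphism A -> K}), forall g, g \in gs -> f g = 0.
Proof.
move=> not1; pose I g := exists c : nat -> A, g = \sum_(i < size gs) c i * gs`_i.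
have pI : proper_ideal_of I.
  split=> [|_ _ [c ->] [c' ->]|a _ [c ->]|[c def1]].
  - by exists (fun=> 0); rewrite big1 // => i _; rewrite mul0r.
  - exists (fun i => c i + c' i); rewrite -big_split.
    by apply: eq_bigr => i _; rewrite mulrDl.
  - by exists (fun i => a * c i); rewrite mulr_sumr; apply: eq_bigr => i _; rewrite mulrA.
  - apply: not1; exists (mkseq c (size gs)); rewrite def1.
    by apply: eq_bigr => i _; rewrite nth_mkseq.
have [P sP] := exists_prime_ideal pI.
have [K [f [ker_f _]]] := prime_ideal_field P.
exists K, f => g /(nthP 0)[j lt_j <-]; apply/ker_f/sP.
exists (fun i => (i == j)%:R); rewrite (bigD1 (Ordinal lt_j)) //= eqxx mul1r big1 ?addr0 // => i.
by rewrite -val_eqE /= => /negPf ->; rewrite mul0r.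
Qed.

(** A common zero of the derivatives up to order [L] provides Taylor coefficients: the [j]-th
    coefficient of [f i] along the jet is the value of its [j]-th derivative divided by [j!]. *)
Lemma jet_of_consistent (C : fieldType) n m s (f : 'I_s -> {mpoly C[m]}) L :
  (forall i, i.+1%:R != 0 :> C) -> (0 < n)%N ->
  ~ one_in_ideal (ders n f L (lvl n m L)) ->
  exists (k : fieldType) (h : {rmorphism C -> k}) (x : nat -> {poly k}),
    (forall v, (x v)^`() = x (n + v)%N) /\
    (forall i, vge L.+1 (jet_eval (polyC \o h) x (f i))).
Proof.
move=> char0C n_gt0 /exists_residue_field[k [phi phi0]]; set K := lvl n m L in phi phi0.
pose h : {rmorphism C -> k} := phi \o @mpolyC K C.
have char0 i : i.+1%:R != 0 :> k by rewrite -(rmorph_nat h) fmorph_eq0.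
have fact_neq0 i : (i`!)%:R != 0 :> k by rewrite -(prednK (fact_gt0 i)).
pose X v : k := if insub v is Some w then phi 'X_w else 0.
have X0 v : (K <= v)%N -> X v = 0 by move=> leKv; rewrite /X insubF // ltnNge leKv.
(* As [n > 0], the index [v + n * j] is at least [K] for [j > K], where [X] is 0. Nothing is
   truncated, and the shift rule for derivatives holds exactly. *)
pose x v := \poly_(j < K.+1) (X (v + n * j)%N / (j`!)%:R).
have coef_x v j : (x v)`_j = X (v + n * j)%N / (j`!)%:R.
  rewrite coef_poly; case: ltnP => // leKj; rewrite X0 ?mul0r //.
  apply: leq_trans (leq_addl _ _); apply: leq_trans (ltnW leKj) _.
  by rewrite leq_pmull.
have x_deriv v : (x v)^`() = x (n + v)%N.
  apply/polyP => j; rewrite coef_deriv !coef_x mulnS addnCA addnA factS natrM -[LHS]mulr_natr.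
  by rewrite invfM [(j.+1%:R)^-1 * _]mulrC mulrA divfK.
exists k, h, x; split=> // i.
pose D := @deriv k.
have dD : deriv_along idfun D by split=> a b; rewrite /D ?derivD ?derivM.
have D_h c : D ((polyC \o h) c) = 0 by rewrite /D /= derivC.
have eval0 (g : {mpoly C[K]}) : (jet_eval (polyC \o h) x g)`_0 = phi g.
  rewrite -horner_coef0.
  apply: (mpoly_rmorph_ext (phi := horner_eval 0 \o mmap (polyC \o h) (fun v : 'I_K => x v))
    (psi := phi)) => [c|v] /=; rewrite /horner_eval.
    by rewrite mmapC /= hornerC.
  by rewrite mmapX mmap1U horner_coef0 coef_x muln0 addn0 fact0 divr1 /X valK.
have lem : (m <= K)%N by apply: (@leq_lvl n m 0 L).
move=> j lt_j; have := phi0 (liftP K (dder n j (f i))).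
rewrite -eval0 jet_eval_liftP; last by apply: leq_lvl.
rewrite (jet_eval_dder dD D_h x_deriv) => dj0.
have : (iter j D (jet_eval (polyC \o h) x (f i)))`_0 = 0.
  apply: dj0; apply/flattenP; exists [seq liftP K (dder n j (f t)) | t <- enum 'I_s].
    by apply/mapP; exists j => //; rewrite mem_iota.
  by apply/mapP; exists i => //; rewrite mem_enum.
rewrite -[iter j D _]/(derivn j _) coef_derivn ?add0n ?addn0 ffactnn -mulr_natr => /eqP.
by rewrite mulf_eq0 (negPf (fact_neq0 j)) orbF => /eqP.
Qed.

Lemma consistent_not_one_in_diff_ideal (C : fieldType) n m s (f : 'I_s -> {mpoly C[m]}) d0 L :
  (forall i, i.+1%:R != 0 :> C) -> (0 < n)%N -> (n <= m)%N -> (1 < d0)%N ->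
  (forall i, msize (f i) <= d0)%N ->
  ((d0 ^ (4 ^ m.+1)) ^ (2 * m.+1) <= L.+1)%N ->
  ~ one_in_ideal (ders n f L (lvl n m L)) -> ~ one_in_diff_ideal n f.
Proof.
move=> char0C n_gt0 le_nm d0_gt1 szf leL /(jet_of_consistent char0C n_gt0)[k [h0 [x [x_deriv vf]]]].
have char0 i : i.+1%:R != 0 :> k by rewrite -(rmorph_nat h0) fmorph_eq0.
have x_shift (l l' : 'I_m) : l' = (l + n)%N :> nat -> (x l)^`() = x l'.
  by move=> ->; rewrite x_deriv addnC.
have [E [h [d [z [dd d_h d_z zf]]]]] :=
  differential_point_of_jet (p := fun l : 'I_m => x l) char0 x_shift d0_gt1.
pose z0 v : E := if insub v is Some l then z l else 0.
(* The first [n] coordinates are prolonged to all orders by iterating [d]; [d_z] makes the result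
   agree with [z] on the first [m] indices. *)
pose y v := iter (v %/ n) d (z0 (v %% n)%N).
have d_y v : d (y v) = y (n + v)%N.
  by rewrite /y divnDl ?dvdnn // divnn n_gt0 modnDl.
have y_z (l : 'I_m) : y l = z l.
  case: l => v; elim/ltn_ind: v => v IHv lt_v /=.
  have [lt_vn|le_nv] := ltnP v n.
    by rewrite /y divn_small // modn_small //= /z0 insubT.
  rewrite -{1}(subnKC le_nv) -d_y.
  have lt_v' : (v - n < m)%N by apply: leq_ltn_trans lt_v; apply: leq_subr.
  rewrite -[y _]/(y (Ordinal lt_v')) IHv; last by rewrite -subn_gt0 subKn.
  by apply: d_z => /=; rewrite subnK.
apply: (@solution_not_one_in_diff_ideal C E (h \o h0) d n y) => // [c|i]; first exact: d_h.
rewrite /jet_eval (@mmap_ext _ _ _ _ _ z) //.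
have map_eq (S : comNzRingType) (g : {rmorphism k -> S}) (w : 'I_m -> S) q :
    mmap g w (map_mpoly h0 q) = mmap (g \o h0) w q.
  apply: (mpoly_rmorph_ext (phi := mmap g w \o map_mpoly h0) (psi := mmap (g \o h0) w))
    => [c|l] /=; first by rewrite map_mpolyC !mmapC.
  by rewrite map_mpolyX !mmapX !mmap1U.
rewrite -map_eq; apply: zf.
  apply: leq_trans (szf i); rewrite !msizeE; apply/bigmax_leqP_seq => e e_q _.
  rewrite -msizeE; apply: msize_mdeg_lt; move: e_q.
  by rewrite !mcoeff_msupp mcoeff_map_mpoly fmorph_eq0.
rewrite map_eq; apply: vge_le (vf i).
by apply: leq_trans leL; rewrite /deg_bound subn0.
Qed.

(** If constants do not generate 1 they are all 0, and then the zero point with the zero derivation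
    is a solution. *)
Lemma one_in_ideal_of_diff_const (C : fieldType) n m s (f : 'I_s -> {mpoly C[m]}) :
  (forall i, exists c, f i = c%:MP) ->
  one_in_diff_ideal n f -> one_in_ideal (ders n f 0 m).
Proof.
move=> constf; apply: boolp.contraPP => /exists_residue_field[k [phi phi0]].
have f0 i : f i = 0.
  have [c def_f] := constf i.
  have : phi (liftP m (f i)) = 0.
    apply: phi0; apply/flattenP; exists [seq liftP m (dder n 0 (f t)) | t <- enum 'I_s].
      by rewrite inE.
    by apply/mapP; exists i => //; rewrite mem_enum.
  rewrite def_f /liftP comp_mpolyC => /eqP.
  by rewrite -[phi _]/((phi \o @mpolyC m C) c) fmorph_eq0 => /eqP ->; rewrite mpolyC0.
apply: (@solution_not_one_in_diff_ideal C C idfun (fun=> 0) n (fun=> 0)) => //.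
  by split=> a b; rewrite ?addr0 ?mul0r ?mulr0 ?addr0.
by move=> i; rewrite f0 /jet_eval rmorph0.
Qed.

(** With [N.+1 <= 2 ^ N] the left side is at most [2 ^ (3 * N + 4)], and [3 * N + 4 <= 5 * N]
    because [2 <= N]. *)
Lemma exponent_bound N nu : (2 <= N)%N -> (0 < nu)%N ->
  (2 * 4 ^ N.+1 * (2 * N.+1) <= 2 ^ (5 * nu ^ 2 * N))%N.
Proof.
move=> N2 nu0; have leN : (N.+1 <= 2 ^ N)%N by apply: ltn_expl.
apply: (@leq_trans (2 ^ (5 * N))); last first.
  rewrite leq_exp2l // leq_mul2r; apply/orP; right.
  by rewrite leq_pmulr // expn_gt0 nu0.
apply: (@leq_trans (2 * 4 ^ N.+1 * (2 * 2 ^ N))).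
  by rewrite leq_mul2l leq_mul2l leN !orbT.
have -> : (4 ^ N.+1 = 2 ^ (2 * N.+1))%N by rewrite expnM.
rewrite -!expnS -expnD leq_exp2l //; lia.
Qed.

Theorem theorem5p1 (R : realType) :
  exists c : nat, (0 < c)%N /\
  forall (n e s : nat) (f : 'I_s -> {mpoly R[i][e.+1 * n]}) (dV : int) (degV : nat),
    (1 <= e)%N ->
    is_dim (Vset f) dV ->
    is_degree (Vset f) degV ->
    exists L : nat,
      (L <= (e.+1 * n * maxn (degf f) degV) ^ (2 ^ (c * (nu_of dV) ^ 2 * (e.+1 * n))))%N /\
      (one_in_diff_ideal n f <-> one_in_ideal (ders n f L (lvl n (e.+1 * n) L))).
Proof.
(* The constant 5 comes from [exponent_bound]. *)
exists 5%N; split=> // n e s f dV degV e_gt0 _ _.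
set N := (e.+1 * n)%N in f *; set D := maxn _ _.
have to_diff L : one_in_ideal (ders n f L (lvl n N L)) -> one_in_diff_ideal n f.
  by move=> one; exists L, (lvl n N L).
have szf i : (msize (f i) <= D.+1)%N.
  have le_deg : ((msize (f i)).-1 <= D)%N.
    by apply: leq_trans (leq_maxl _ _); apply: (@leq_bigmax _ (fun t => (msize (f t)).-1) i).
  by apply: leq_trans (leqSpred _) _.
(* If [N * D = 0] the bound forces [L = 0]; there are then no variables or only degrees 0, so every
   [f i] is constant. *)
have [ND0|ND_gt0] := posnP (N * D)%N.
  exists 0%N; split=> //; split; last exact: to_diff.
  apply: one_in_ideal_of_diff_const => i; exists (f i)@_0.
  move/eqP: ND0; rewrite muln_eq0 => /orP[/eqP N0|/eqP D0].
    by apply: nvar0_mpolyC_eq.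
  by apply: msize1_polyC; rewrite -[1%N]/(0.+1) -D0.
have [N_gt0 D_gt0] : (0 < N)%N /\ (0 < D)%N by apply/andP; rewrite -muln_gt0.
have n_gt0 : (0 < n)%N by move: N_gt0; rewrite muln_gt0 => /andP[].
have N_gt1 : (1 < N)%N by rewrite /N; nia.
have ND_gt1 : (1 < N * D)%N by nia.
pose L := ((N * D) ^ (2 ^ (5 * nu_of dV ^ 2 * N)))%N.
exists L; split=> //; split; last exact: to_diff.
(* The choice [d0 = (N * D) ^ 2] exceeds 1 and is at least [D.+1], so it bounds every [msize (f i)];
   its square is the extra factor 2 in [exponent_bound]. *)
apply: boolp.contraPP; apply: (@consistent_not_one_in_diff_ideal _ n N s f ((N * D) ^ 2)).
- by move=> i; rewrite pnatr_eq0.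
- exact: n_gt0.
- by rewrite /N leq_pmull.
- by rewrite -[1%N](exp1n 2) ltn_exp2r.
- by move=> i; apply: leq_trans (szf i) _; rewrite -mulnn; nia.
- apply: ltnW; rewrite ltnS /L -!expnM leq_exp2l //.
  rewrite mulnA; apply: exponent_bound => //.
  by rewrite /nu_of; case: ifP => // _; rewrite leq_max.
Qed.
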